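(* Let $\mathcal{T}=\{K_i : 1\le i\le q\}$ be a triangle patch around a point $z\in\mathbb{R}^2$, and let $n\ge 1$. Then the following three statements are equivalent, and each of them holds. (a) If $u\in\mathbb{P}_n(\Omega)$ and $(u,w)_{\mathcal{T}}=0$ for all $w\in\mathbb{P}_{n-1}(\mathcal{T})$, then $u=0$. (b) $\displaystyle\bigcap_{i=1}^{q}\mathbb{P}_{n-1}^{\perp}(K_i)=\{0\}$ (each $\mathbb{P}_{n-1}^\perp(K_i)$ being regarded as a space of bivariate real polynomials). (c) The map $\Pi_n^{\mathcal{T}}\colon \mathbb{P}_n(\Omega)\to\mathbb{P}_{n-1}(\mathcal{T})$ is injective.
   Context: Triangle patch: a triangle patch around $z\in\mathbb{R}^2$ is a finite set $\mathcal{T}=\{K_i:1\le i\le q\}$ ($q\ge 3$) of open (nondegenerate) triangles that are pairwise disjoint, have $z$ as a common vertex, and are such that for all $1\le i\le q$ (indices cyclic mod $q$: $K_0:=K_q$, $K_{q+1}:=K_1$, and analogously for the points $A_i$) the triangles $K_i$ and $K_{i+1}$ have one common edge, joining $z$ to a common vertex $A_i$. Thus $K_i$ is the interior of the convex hull of $z,A_{i-1},A_i$, and the union of the closed triangles covers a neighborhood of $z$. Polynomial spaces: for $D\subset\mathbb{R}^2$, $\mathbb{P}_n(D)$ is the space of (restrictions to $D$ of) real polynomials in two variables of total degree at most $n$. Polynomials on open sets are identified with polynomials on $\mathbb{R}^2$. Let $\Omega:=\operatorname{int}\big(\bigcup_{i=1}^q\overline{K_i}\big)$ and $\mathfrak{S}:=\Omega\cap\bigcup_{i=1}^q\partial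 K_i$. Put $$\mathbb{P}_n(\mathcal{T}):=\{f:\Omega\setminus\mathfrak{S}\to\mathbb{R} \mid f|_{K_i}\in\mathbb{P}_n(K_i)\text{ for all } i=1,\dots,q\}.$$ $\mathbb{P}_n(\Omega)$ is regarded as a linear subspace of $\mathbb{P}_n(\mathcal{T})$ by restriction. Inner products: for each $i$ let $\omega_i:=a_ib_ic_i$ be the product of the three barycentric coordinates of $K_i$ (affine linear functions vanishing on the respective edges of $K_i$ and positive on $K_i$). Put $(u,v)_{K_i}:=\int_{K_i}u\,v\,\omega_i\,dx\,dy$ and $(u,v)_{\mathcal{T}}:=\sum_{i=1}^q (u,v)_{K_i}$. $\mathbb{P}_{n-1}^{\perp}(K_i)$ is the orthogonal complement of $\mathbb{P}_{n-1}(K_i)$ in $\mathbb{P}_n(K_i)$ with respect to $(\cdot,\cdot)_{K_i}$. $\Pi_n^{\mathcal{T}}\colon\mathbb{P}_n(\Omega)\to\mathbb{P}_{n-1}(\mathcal{T})$ is the restriction to $\mathbb{P}_n(\Omega)$ of the orthogonal projection of $\mathbb{P}_n(\mathcal{T})$ onto $\mathbb{P}_{n-1}(\mathcal{T})$ with respect to $(\cdot,\cdot)_{\mathcal{T}}$. *)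

(* Defs.v *)
From HB Require Import structures.
From mathcomp Require Import all_boot all_order all_algebra.
From mathcomp Require Import all_classical all_reals all_analysis.
(* The notations of mpoly clash with those of mathcomp-analysis. *)
From mathcomp Require Import -(notations) mpoly.

Set Implicit Arguments.
Unset Strict Implicit.
Unset Printing Implicit Defensive.
Import Order.TTheory GRing.Theory Num.Theory.
Import numFieldNormedType.Exports.
Local Open Scope classical_set_scope.
Local Open Scope ring_scope.

Definition convex_hull (R : realType) (S : set (R * R)) : set (R * R) :=
  smallest (@convex_set R (R * R)%type) S.

Definition open_triangle (R : realType) (a b c : R * R) : set (R * R) :=
  interior (convex_hull [set a; b; c]).

Definition boundary (T : topologicalType) (D : set T) : set T :=
  closure D `\` interior D.

(* Twice the signed area of the triangle (a, b, c). *)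
Definition signed_area2 (R : realType) (a b c : R * R) : R :=
  (b.1 - a.1) * (c.2 - a.2) - (c.1 - a.1) * (b.2 - a.2).

Definition nondegenerate_triangle (R : realType) (a b c : R * R) : Prop :=
  signed_area2 a b c != 0.

(* By Cramer's rule, the barycentric coordinate at x of the vertex a of a
   nondegenerate triangle (a, b, c): affine in x, 1 at a and 0 on the edge bc. *)
Definition barycentric (R : realType) (a b c x : R * R) : R :=
  signed_area2 x b c / signed_area2 a b c.

Definition bubble (R : realType) (a b c x : R * R) : R :=
  barycentric a b c x * barycentric b c a x * barycentric c a b x.

Definition polyfun (R : realType) (p : mpoly 2 R) (x : R * R) : R :=
  meval (tnth [tuple x.1; x.2]) p.

(* msize is the total degree plus one, and 0 for the zero polynomial. *)
Definition degree_le (R : realType) (n : nat) (p : mpoly 2 R) : Prop :=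
  (msize p <= n.+1)%N.

(* Throughout, a real function on D `<=` R * R is represented by its extension
   by zero to the plane, so that two functions on D agree iff they are equal;
   f \_ D restricts f to D in this sense. *)
Definition Pspace (R : realType) (n : nat) (D : set (R * R)) :
    set (R * R -> R) :=
  [set polyfun p \_ D | p in @degree_le R n].

Definition ip_triangle (R : realType) (a b c : R * R) (u v : R * R -> R) : R :=
  \int[(@lebesgue_measure R \x @lebesgue_measure R)%E]_(x in open_triangle a b c)
    (u x * v x * bubble a b c x).

Definition Porth (R : realType) (n : nat) (a b c : R * R) :
    set (R * R -> R) :=
  [set f | Pspace n (open_triangle a b c) f /\
     forall w, Pspace n.-1 (open_triangle a b c) w ->
       ip_triangle a b c f w = 0].

(* The polynomials on R^2 whose restriction to the triangle is in Porth. *)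
Definition Porth_poly (R : realType) (n : nat) (a b c : R * R) :
    set (mpoly 2 R) :=
  [set p | degree_le n p /\ Porth n a b c (polyfun p \_ (open_triangle a b c))].

(* The points A_1, ..., A_q are indexed by 'I_q; ord_pred is the cyclic
   predecessor, and the i-th triangle has vertices z, A_(i-1), A_i.  Hence the
   i-th and (i+1)-st triangles share the edge joining z to A_i. *)
Definition Ktri (R : realType) (z : R * R) (q : nat) (A : 'I_q -> R * R)
    (i : 'I_q) : set (R * R) :=
  open_triangle z (A (ord_pred i)) (A i).

Record triangle_patch (R : realType) (z : R * R) (q : nat)
    (A : 'I_q -> R * R) : Prop := {
  patch_ge3 : (3 <= q)%N ;
  patch_nondegenerate : forall i, nondegenerate_triangle z (A (ord_pred i)) (A i) ;
  patch_disjoint : forall i j, i != j -> Ktri z A i `&` Ktri z A j = set0 }.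

Definition Omega (R : realType) (z : R * R) (q : nat) (A : 'I_q -> R * R) :
    set (R * R) :=
  interior (\bigcup_i closure (Ktri z A i)).

Definition skeleton (R : realType) (z : R * R) (q : nat) (A : 'I_q -> R * R) :
    set (R * R) :=
  Omega z A `&` \bigcup_i boundary (Ktri z A i).

Definition PspaceT (R : realType) (n : nat) (z : R * R) (q : nat)
    (A : 'I_q -> R * R) : set (R * R -> R) :=
  [set f | f \_ (Omega z A `\` skeleton z A) = f /\
     forall i, Pspace n (Ktri z A i) (f \_ (Ktri z A i))].

Definition ip_patch (R : realType) (z : R * R) (q : nat) (A : 'I_q -> R * R)
    (u v : R * R -> R) : R :=
  \sum_(i < q) ip_triangle z (A (ord_pred i)) (A i) u v.

(* The orthogonal projection onto PspaceT n z A, characterized by v being in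
   that space and u - v orthogonal to it. *)
Definition orth_proj (R : realType) (n : nat) (z : R * R) (q : nat)
    (A : 'I_q -> R * R) (u : R * R -> R) : R * R -> R :=
  xget 0 [set v | PspaceT n z A v /\
    forall w, PspaceT n z A w -> ip_patch z A (u - v) w = 0].

(* Its argument is a function on Omega, embedded in PspaceT by restriction. *)
Definition PiT (R : realType) (n : nat) (z : R * R) (q : nat)
    (A : 'I_q -> R * R) (u : R * R -> R) : R * R -> R :=
  orth_proj n.-1 z A (u \_ (Omega z A `\` skeleton z A)).

(* Main.v *)
Require Import Defs.
From HB Require Import structures.
From mathcomp Require Import all_boot all_order all_algebra.
From mathcomp Require Import all_classical all_reals all_analysis.
From mathcomp Require Import -(notations) mpoly.
From mathcomp Require Import measurable_realfun ring lra zify.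
Set Implicit Arguments.
Unset Strict Implicit.
Unset Printing Implicit Defensive.
Import Order.TTheory GRing.Theory Num.Theory.
Import numFieldNormedType.Exports.
Local Open Scope classical_set_scope.
Local Open Scope ring_scope.

(* Write P and Q for the vectors from z to the two other vertices of a triangle
   of the patch, and b, c for their barycentric coordinates. A polynomial u of
   degree at most n which is orthogonal to all polynomials of lower degree is an
   eigenfunction, L u = - n (n + 5) u, of the operator
     L = b D_P^2 + 2 D_P + c D_Q^2 + 2 D_Q - E (E + 5),   E = (x - z) . grad,
   which is symmetric for the bubble weight (divergence theorem). At z this is
   a recurrence relating D_P^j D_Q^k u (z) in two consecutive orders j + k, and
   E does not depend on the triangle.
   Suppose that u vanishes exactly to order m at z. If m > 0, the recurrences in
   the triangles on both sides of an edge W_(k+1) yield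
     2 det(W_k, W_(k+2)) = - (m + 1) (det(W_k, W_(k+1)) + det(W_(k+1), W_(k+2))),
   so that any two consecutive triangles span a reflex angle at z. This forces
   q = 3, and then summing over k gives m = 0. If m = 0, the recurrence of order
   0 says that the differential of u at z has a constant sum on consecutive
   edges; going once around z shows that it vanishes, hence so does u (z). *)

(** * Polynomials in two variables *)

Section PolynomialFunctions.
Context {R : realType}.
Implicit Types (p q : mpoly 2 R) (x v : R * R).

Definition coord (i : 'I_2) : mpoly 2 R := mpolyX R (mnm1 i).

Lemma polyfunC c x : polyfun (mpolyC 2 c) x = c :> R.
Proof. exact: mevalC. Qed.

Lemma polyfunD p q x : polyfun (p + q) x = polyfun p x + polyfun q x.
Proof. exact: mevalD. Qed.

Lemma polyfunB p q x : polyfun (p - q) x = polyfun p x - polyfun q x.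
Proof. exact: mevalB. Qed.

Lemma polyfunM p q x : polyfun (p * q) x = polyfun p x * polyfun q x.
Proof. exact: mevalM. Qed.

Lemma polyfunZ c p x : polyfun (c *: p) x = c * polyfun p x.
Proof. exact: mevalZ. Qed.

Lemma polyfun0 x : polyfun 0 x = 0 :> R.
Proof. exact: meval0. Qed.

Lemma polyfun_coord0 x : polyfun (coord ord0) x = x.1.
Proof. by rewrite /polyfun mevalXU. Qed.

Lemma polyfun_coord1 x : polyfun (coord ord_max) x = x.2.
Proof. by rewrite /polyfun mevalXU. Qed.

(** Constants and the two coordinates generate the polynomial ring, so continuity, measurability,
    boundedness and differentiation rules need to be checked only on generators, sums and
    products. *)
Lemma mpoly2_ind (T : mpoly 2 R -> Prop) :
    (forall c, T (mpolyC 2 c)) -> T (coord ord0) -> T (coord ord_max) ->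
    (forall p q, T p -> T q -> T (p + q)) ->
    (forall p q, T p -> T q -> T (p * q)) ->
  forall p, T p.
Proof.
move=> TC T0 T1 TD TM; elim/mpolyind => [|c m p _ _ Tp]; first exact: (TC 0).
apply: (TD) => //; rewrite -mul_mpolyC; apply: (TM) => //.
rewrite mpolyXE_id big_ord_recl big_ord1 (_ : lift ord0 ord0 = ord_max); last exact: val_inj.
have TX q k : T q -> T (q ^+ k).
  by move=> Tq; elim: k => [|k IH]; [exact: (TC 1)|rewrite exprS; exact: (TM)].
by apply: (TM); apply: (TX).
Qed.

End PolynomialFunctions.

Section DirectionalDerivative.
Context {R : realType}.
Implicit Types (p q u w : mpoly 2 R) (v : R * R).

Definition dird v p : mpoly 2 R :=
  v.1 *: mderiv ord0 p + v.2 *: mderiv ord_max p.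

Lemma dirdC v c : dird v (mpolyC 2 c) = 0.
Proof. by rewrite /dird !mderivC !scaler0 addr0. Qed.

Lemma dird0 v : dird v 0 = 0.
Proof. by rewrite /dird !mderiv0 !scaler0 addr0. Qed.

Lemma dirdD v p q : dird v (p + q) = dird v p + dird v q.
Proof. by rewrite /dird !mderivD !scalerDr addrACA. Qed.

Lemma dirdN v p : dird v (- p) = - dird v p.
Proof. by rewrite /dird !mderivN !scalerN opprD. Qed.

Lemma dirdB v p q : dird v (p - q) = dird v p - dird v q.
Proof. by rewrite dirdD dirdN. Qed.

Lemma dirdM v p q : dird v (p * q) = dird v p * q + p * dird v q.
Proof.
by rewrite /dird !mderivM -!mul_mpolyC; ring.
Qed.

Lemma dirdZ v c p : dird v (c *: p) = c *: dird v p.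
Proof. by rewrite -mul_mpolyC dirdM dirdC mul0r add0r mul_mpolyC. Qed.

Lemma dird_nat v k : dird v k%:R = 0.
Proof. by rewrite -(mpolyCMn 2 k 1) dirdC. Qed.

Lemma dird_comm v (w : R * R) p : dird v (dird w p) = dird w (dird v p).
Proof.
rewrite /dird !mderivD !mderivZ (mderiv_comm ord_max ord0).
by rewrite -!mul_mpolyC; ring.
Qed.

Lemma dird_scale c v p : dird (c *: v) p = c *: dird v p.
Proof. by rewrite /dird/= !scalerDr !scalerA. Qed.

Lemma dird_lin v (w : R * R) p : dird (v - w) p = dird v p - dird w p.
Proof. by rewrite /dird/= !scalerBl opprD addrACA. Qed.

Lemma dird_iter_comm v (w : R * R) k p :
  dird v (iter k (dird w) p) = iter k (dird w) (dird v p).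
Proof. by elim: k => //= k <-; rewrite dird_comm. Qed.

Lemma dird_iterZ v k (m : R) p :
  iter k (dird v) (m *: p) = m *: iter k (dird v) p.
Proof. by elim: k => //= k ->; rewrite dirdZ. Qed.

Lemma dird_iterB v k p q :
  iter k (dird v) (p - q) = iter k (dird v) p - iter k (dird v) q.
Proof. by elim: k => //= k ->; rewrite dirdB. Qed.

End DirectionalDerivative.

(** * The Jacobi operator *)

Section JacobiOperator.
Context {S : comPzRingType} (D1 D2 : S -> S) (b c : S).
Hypotheses (D1D : {morph D1 : u w / u + w}) (D2D : {morph D2 : u w / u + w}).
Hypotheses (D1N : {morph D1 : u / - u}) (D2N : {morph D2 : u / - u}).
Hypotheses (D1M : forall u w, D1 (u * w) = D1 u * w + u * D1 w)
  (D2M : forall u w, D2 (u * w) = D2 u * w + u * D2 w).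
Hypotheses (D1n : forall k, D1 k%:R = 0) (D2n : forall k, D2 k%:R = 0).
Hypothesis D21 : forall u, D2 (D1 u) = D1 (D2 u).
Hypotheses (D1b : D1 b = 1) (D1c : D1 c = 0) (D2b : D2 b = 0) (D2c : D2 c = 1).
Implicit Types u w : S.

(** For the derivatives along two edges from a vertex and the dual barycentric coordinates, this is
    the Euler operator centred at that vertex. Only the axioms of two commuting derivations are
    assumed, which reduces all identities to [ring]. *)
Definition euler u : S := b * D1 u + c * D2 u.

(* The last parenthesis is (euler + k) (euler + k + 5): with this
   parametrization a derivation only shifts i, j and k. *)
Definition jacobi_op (i j k : nat) u : S :=
  b * D1 (D1 u) + i%:R * D1 u + (c * D2 (D2 u) + j%:R * D2 u) -
  (euler (euler u) + (2 * k + 5)%:R * euler u + (k * (k + 5))%:R * u).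

(** Since [D1 (euler u) = euler (D1 u) + D1 u], the factor (E + k)(E + k + 5) becomes (E + k + 1)(E
    + k + 6). Differentiating the coefficient [b] yields one more [D1 (D1 u)], which raises [i]; [j]
    stays because [D1 c = 0]. *)
Lemma D1_jacobi_op i j k u :
  D1 (jacobi_op i j k u) = jacobi_op i.+1 j k.+1 (D1 u).
Proof.
rewrite /jacobi_op /euler !(D1D, D2D, D1N, D1M, D2M, D1n, D21, D1b, D1c, D2b, D2c).
by rewrite (D1n 0) (D1n 1) !(natrD, natrM) -!natr1; ring.
Qed.

Lemma D2_jacobi_op i j k u :
  D2 (jacobi_op i j k u) = jacobi_op i j.+1 k.+1 (D2 u).
Proof.
rewrite /jacobi_op /euler !(D1D, D2D, D2N, D1M, D2M, D2n, D21, D1b, D1c, D2b, D2c).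
by rewrite ?(D1n 0) ?(D1n 1) ?(D2n 0) ?(D2n 1) !(natrD, natrM) -!natr1; ring.
Qed.

Lemma iter_jacobi_op j k u :
  iter j D1 (iter k D2 (jacobi_op 2 2 0 u)) =
  jacobi_op (2 + j) (2 + k) (j + k) (iter j D1 (iter k D2 u)).
Proof.
elim: j => [|j IH] /=; last by rewrite IH D1_jacobi_op.
by elim: k => //= k ->; rewrite D2_jacobi_op.
Qed.

(* Lagrange's identity: with the third barycentric coordinate 1 - b - c the
   operator is formally self-adjoint for the bubble weight. *)
Lemma jacobi_op_selfadjoint u w :
  let omega := (1 - b - c) * b * c in
  let W1 := w * D1 u - u * D1 w in
  let W2 := w * D2 u - u * D2 w in
  let h3 := b * c * (W2 - W1) in
  omega * (w * jacobi_op 2 2 0 u - u * jacobi_op 2 2 0 w) =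
  D1 (omega * ((1 - b - c) * b * W1 - h3)) +
  D2 (omega * ((1 - b - c) * c * W2 + h3)).
Proof.
move=> omega W1 W2 h3; rewrite /omega /h3 /W1 /W2 /jacobi_op /euler.
rewrite !(D1D, D2D, D1N, D2N, D1M, D2M, D21, D1b, D1c, D2b, D2c) ?(D1n 0) ?(D1n 1) ?(D2n 0) ?(D2n 1).
by ring.
Qed.

(** All second order and Euler terms carry a factor [b] or [c], and both vanish at the vertex. This
    is why the Taylor recurrence links only two consecutive orders. *)
Lemma jacobi_op_eval (S' : comPzRingType) (ev : {rmorphism S -> S'}) i j k u :
    ev b = 0 -> ev c = 0 ->
  ev (jacobi_op i j k u) = i%:R * ev (D1 u) + j%:R * ev (D2 u) -
    (k * (k + 5))%:R * ev u.
Proof.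
move=> b0 c0; rewrite /jacobi_op /euler.
rewrite rmorphB !(rmorphD, rmorphM, rmorph_nat) b0 c0.
by ring.
Qed.

End JacobiOperator.

(** * Degree estimates, and polynomials determined by their derivatives at a point *)

Section Degree.
Context {R : realType}.
Implicit Types (p q u : mpoly 2 R) (v : R * R).

Lemma msize_leP p k :
  (forall m : multinom 2, (k <= mdeg m)%N -> mcoeff m p = 0) <->
  (msize p <= k)%N.
Proof.
split=> [H|pk m km]; last first.
  by apply/eqP; rewrite mcoeff_eq0 msize_mdeg_ge// (leq_trans pk).
rewrite msizeE big_seq; elim/big_ind: _ => // [x y|m].
  by rewrite geq_max => -> ->.
rewrite mcoeff_msupp ltnNge; apply: contraNN => /H ->; exact: eqxx.
Qed.

Lemma msize_add p q k :
  (msize p <= k)%N -> (msize q <= k)%N -> (msize (p + q) <= k)%N.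
Proof. by move=> pk qk; rewrite (leq_trans (msizeD_le _ _))// geq_max pk. Qed.

Lemma msize_sub p q k :
  (msize p <= k)%N -> (msize q <= k)%N -> (msize (p - q) <= k)%N.
Proof. by move=> pk qk; rewrite msize_add ?msizeN. Qed.

Lemma msize_scale (a : R) p k : (msize p <= k)%N -> (msize (a *: p) <= k)%N.
Proof. exact/leq_trans/msizeZ_le. Qed.

Lemma msize_nat_mul (a : nat) p k :
  (msize p <= k)%N -> (msize (a%:R * p) <= k)%N.
Proof.
by move=> pk; rewrite -(mpolyCMn 2 a 1) mul_mpolyC msize_scale.
Qed.

Lemma msize_mul2 p q k :
  (msize p <= 2)%N -> (msize q <= k)%N -> (msize (p * q) <= k.+1)%N.
Proof.
move=> p2 qk; have [->|p0] := eqVneq p 0; first by rewrite mul0r msize0.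
have [->|q0] := eqVneq q 0; first by rewrite mulr0 msize0.
by rewrite msizeM// -subn1 (leq_trans (leq_sub2r 1 (leq_add p2 qk)))// subn1.
Qed.

Lemma msize_mderiv i p k :
  (msize p <= k)%N -> (msize (mderiv i p) <= k.-1)%N.
Proof.
move=> /msize_leP pk; apply/msize_leP => m km.
rewrite mcoeff_mderiv pk ?mul0rn// mdegD mdeg1; lia.
Qed.

Lemma msize_dird v p k : (msize p <= k)%N -> (msize (dird v p) <= k.-1)%N.
Proof. by move=> pk; rewrite msize_add ?msize_scale ?msize_mderiv. Qed.

Lemma coord_mderivX i (m : multinom 2) :
  coord i * mderiv i (mpolyX R m) = (m i)%:R *: mpolyX R m.
Proof.
rewrite mderivX -scalerAr -mpolyXD; have [->|mi] := eqVneq (m i) 0%N.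
  by rewrite !scale0r.
congr (_ *: mpolyX R _); apply/mnmP => j; rewrite mnmDE mnmBE mnm1E.
by case: eqP => [<-|_]; lia.
Qed.

Lemma coord_mderiv_mcoeff i p (m : multinom 2) :
  mcoeff m (coord i * mderiv i p) = (m i)%:R * mcoeff m p.
Proof.
elim/mpolyind: p => [|c m' p _ _ IH].
  by rewrite mderiv0 mulr0 mcoeff0 mulr0.
rewrite mderivD mulrDr mcoeffD IH mcoeffD mulrDr; congr (_ + _).
rewrite mderivZ -scalerAr coord_mderivX !mcoeffZ mcoeffX mulrCA.
by have [->|_] := eqVneq m' m; rewrite ?mulr0.
Qed.

(* On homogeneous polynomials of degree n the Euler operator is n. *)
Lemma msize_euler_sub (z : R * R) p n : (msize p <= n.+1)%N ->
  (msize ((coord ord0 - mpolyC 2 z.1) * mderiv ord0 p +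
          (coord ord_max - mpolyC 2 z.2) * mderiv ord_max p - n%:R * p) <= n)%N.
Proof.
move=> pn; set d0 := mderiv _ _; set d1 := mderiv _ _.
rewrite (_ : _ - _ = coord ord0 * d0 + coord ord_max * d1 - n%:R * p -
    (mpolyC 2 z.1 * d0 + mpolyC 2 z.2 * d1)); last by ring.
apply: msize_sub; last first.
  by rewrite !mul_mpolyC msize_add ?msize_scale ?(msize_mderiv _ pn).
apply/msize_leP => m; rewrite leq_eqVlt => /predU1P[nm|nm].
  rewrite mcoeffB mcoeffD !coord_mderiv_mcoeff -mulrDl -natrD.
  rewrite (_ : n%:R * p = n%:R *: p); last by rewrite -mul_mpolyC rmorph_nat.
  rewrite mcoeffZ nm mdegE big_ord_recl big_ord1.
  by rewrite (_ : lift ord0 ord0 = ord_max) ?subrr//; exact: val_inj.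
rewrite mcoeffB mcoeffD !coord_mderiv_mcoeff.
have pm : mcoeff m p = 0 by apply: ((msize_leP _ _).2 pn).
rewrite (_ : n%:R * p = n%:R *: p); last by rewrite -mul_mpolyC rmorph_nat.
by rewrite mcoeffZ pm !mulr0 subr0 addr0.
Qed.

(** In characteristic zero, the coefficient at [m] with [m i > 0] reappears in the [i]-th partial
    derivative, multiplied by [m i]. *)
Lemma mpoly_const p : mderiv ord0 p = 0 -> mderiv ord_max p = 0 ->
  p = mpolyC 2 (mcoeff mnm0 p).
Proof.
move=> p0 p1; apply: msize1_polyC; apply/msize_leP => m m0.
have [i mi] : exists i, (0 < m i)%N.
  apply/existsP; apply: contraLR m0; rewrite negb_exists => /forallP H.
  by rewrite mdegE big1// => i _; move: (H i); rewrite lt0n negbK => /eqP.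
have pi : mderiv i p = 0.
  have [->//|->//] : i = ord0 \/ i = ord_max.
  by case: i {mi} => [[|[|]]]// ?; [left|right]; exact: val_inj.
have /eqP := congr1 (mcoeff (mnm_sub m (mnm1 i))) pi.
rewrite mcoeff_mderiv mcoeff0 submK; last by rewrite lep1mP -lt0n.
by rewrite mulrn_eq0/= => /eqP.
Qed.

(** Cramer's rule: the determinant times either partial derivative is a combination of the two
    directional ones. *)
Lemma dird_eq0 (P Q : R * R) p : P.1 * Q.2 - Q.1 * P.2 != 0 ->
  dird P p = 0 -> dird Q p = 0 -> mderiv ord0 p = 0 /\ mderiv ord_max p = 0.
Proof.
move=> D0 Pp Qp.
have e0 : (P.1 * Q.2 - Q.1 * P.2) *: mderiv ord0 p = 0.
  transitivity (Q.2 *: dird P p - P.2 *: dird Q p).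
    by rewrite /dird -!mul_mpolyC mpolyCB !mpolyCM; ring.
  by rewrite Pp Qp !scaler0 subr0.
have e1 : (P.1 * Q.2 - Q.1 * P.2) *: mderiv ord_max p = 0.
  transitivity (P.1 *: dird Q p - Q.1 *: dird P p).
    by rewrite /dird -!mul_mpolyC mpolyCB !mpolyCM; ring.
  by rewrite Pp Qp !scaler0 subr0.
by split; apply/eqP; [move/eqP: e0|move/eqP: e1];
  rewrite -mul_mpolyC mulf_eq0 mpolyC_eq0 (negPf D0).
Qed.

(** Induction on the size: both directional derivatives inherit the hypothesis and are smaller,
    hence zero. Then [p] is a constant, equal to its value at [z]. *)
Lemma mpoly_eq0_taylor (P Q z : R * R) p : P.1 * Q.2 - Q.1 * P.2 != 0 ->
    (forall j k, polyfun (iter j (dird P) (iter k (dird Q) p)) z = 0) ->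
  p = 0.
Proof.
move=> D0; move: {-1}(msize p) (leqnn (msize p)) => n.
elim: n p => [|n IH] p pn T0.
  by apply/eqP; rewrite -msize_poly_eq0 -leqn0.
have Pp : dird P p = 0.
  apply: IH; first exact: msize_dird pn.
  by move=> j k; rewrite -dird_iter_comm -iterSr T0.
have Qp : dird Q p = 0.
  by apply: IH; [exact: msize_dird pn|move=> j k; rewrite -iterSr T0].
have [p0 p1] := dird_eq0 D0 Pp Qp.
have pE := mpoly_const p0 p1.
by have := T0 0%N 0%N; rewrite /= pE polyfunC => ->; rewrite mpolyC0.
Qed.

End Degree.

(** * Barycentric coordinates as affine polynomials *)

Section Barycentric.
Context {R : realType}.
Implicit Types (a b c v x z : R * R).

Definition affine_poly (k0 k1 k2 : R) : mpoly 2 R :=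
  mpolyC 2 k0 + k1 *: coord ord0 + k2 *: coord ord_max.

Lemma dird_coord0 v : dird v (coord ord0) = mpolyC 2 v.1.
Proof.
rewrite /dird /coord !mderivX !mnm1E/= scale0r scaler0 addr0 scale1r.
rewrite (_ : mnm_sub _ _ = mnm0); last by apply/mnmP => j; rewrite mnmBE subnn mnm0E.
by rewrite mpolyX0 -mul_mpolyC mulr1.
Qed.

Lemma dird_coord1 v : dird v (coord ord_max) = mpolyC 2 v.2.
Proof.
rewrite /dird /coord !mderivX !mnm1E/= scale0r scaler0 add0r scale1r.
rewrite (_ : mnm_sub _ _ = mnm0); last by apply/mnmP => j; rewrite mnmBE subnn mnm0E.
by rewrite mpolyX0 -mul_mpolyC mulr1.
Qed.

Lemma dird_affine v k0 k1 k2 :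
  dird v (affine_poly k0 k1 k2) = mpolyC 2 (v.1 * k1 + v.2 * k2).
Proof.
rewrite /affine_poly !dirdD !dirdZ dirdC add0r dird_coord0 dird_coord1.
by rewrite -!mul_mpolyC -!mpolyCM -mpolyCD mulrC [k2 * _]mulrC.
Qed.

Lemma affine_polyD k0 k1 k2 l0 l1 l2 :
  affine_poly k0 k1 k2 + affine_poly l0 l1 l2 =
  affine_poly (k0 + l0) (k1 + l1) (k2 + l2).
Proof. by rewrite /affine_poly -!mul_mpolyC !mpolyCD; ring. Qed.

Lemma affine_polyZ k k0 k1 k2 :
  k *: affine_poly k0 k1 k2 = affine_poly (k * k0) (k * k1) (k * k2).
Proof. by rewrite /affine_poly -!mul_mpolyC !mpolyCM; ring. Qed.

Lemma msize_affine k0 k1 k2 : (msize (affine_poly k0 k1 k2) <= 2)%N.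
Proof.
rewrite /affine_poly !msize_add ?msize_scale ?msizeX ?mdeg1//.
by rewrite msizeC; case: eqP.
Qed.

Lemma polyfun_affine k0 k1 k2 x :
  polyfun (affine_poly k0 k1 k2) x = k0 + k1 * x.1 + k2 * x.2.
Proof.
by rewrite /affine_poly !polyfunD polyfunC !polyfunZ polyfun_coord0 polyfun_coord1.
Qed.

Definition bary_poly a b c : mpoly 2 R :=
  let k := (signed_area2 a b c)^-1 in
  affine_poly ((b.1 * c.2 - c.1 * b.2) * k) ((b.2 - c.2) * k) ((c.1 - b.1) * k).

Lemma polyfun_bary a b c x : polyfun (bary_poly a b c) x = barycentric a b c x.
Proof. by rewrite polyfun_affine /barycentric /signed_area2; ring. Qed.

Lemma dird_bary v a b c : dird v (bary_poly a b c) =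
  mpolyC 2 ((v.1 * (b.2 - c.2) + v.2 * (c.1 - b.1)) / signed_area2 a b c).
Proof. by rewrite dird_affine; congr (mpolyC 2 _); ring. Qed.

Lemma msize_bary a b c : (msize (bary_poly a b c) <= 2)%N.
Proof. exact: msize_affine. Qed.

Definition bubble_poly a b c : mpoly 2 R :=
  bary_poly a b c * bary_poly b c a * bary_poly c a b.

Lemma polyfun_bubble a b c x : polyfun (bubble_poly a b c) x = bubble a b c x.
Proof. by rewrite !polyfunM !polyfun_bary. Qed.

Lemma signed_area2_rot a b c : signed_area2 b c a = signed_area2 a b c.
Proof. by rewrite /signed_area2; ring. Qed.

(** Eliminating one coordinate brings the bubble into the form (1 - b - c) b c required by the
    self-adjointness identity. *)
Lemma bary_sum a b c : signed_area2 a b c != 0 ->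
  bary_poly a b c = 1 - bary_poly b c a - bary_poly c a b.
Proof.
move=> D0; suff e : bary_poly a b c + bary_poly b c a + bary_poly c a b = 1.
  by rewrite -e; ring.
rewrite /bary_poly (signed_area2_rot a b c) -(signed_area2_rot c a b) !affine_polyD.
transitivity (affine_poly 1 0 0); last first.
  by rewrite /affine_poly !scale0r !addr0.
rewrite -!mulrDl; congr affine_poly.
- by rewrite -[RHS](mulfV D0) /signed_area2; ring.
- by rewrite !subrKA subrr mul0r.
- by ring.
Qed.

End Barycentric.

(** * Integrals of polynomials over a triangle *)

Section PolyfunAnalysis.
Context {R : realType}.
Implicit Types (p q : mpoly 2 R) (x : R * R).

Lemma continuous_polyfun p : continuous (polyfun p).
Proof.
elim/(@mpoly2_ind R): p => [c|||p q cp cq|p q cp cq] x.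
- rewrite (_ : polyfun _ = cst c); last by apply/funext => y; rewrite polyfunC.
  exact: cst_continuous.
- rewrite (_ : polyfun _ = fst); last by apply/funext => y; rewrite polyfun_coord0.
  exact: cvg_fst.
- rewrite (_ : polyfun _ = snd); last by apply/funext => y; rewrite polyfun_coord1.
  exact: cvg_snd.
- rewrite (_ : polyfun _ = polyfun p \+ polyfun q); last first.
    by apply/funext => y; rewrite polyfunD.
  by apply: continuousD; [exact: cp|exact: cq].
- rewrite (_ : polyfun _ = polyfun p \* polyfun q); last first.
    by apply/funext => y; rewrite polyfunM.
  by apply: continuousM; [exact: cp|exact: cq].
Qed.

Lemma measurable_polyfun p : measurable_fun setT (polyfun p).
Proof.
elim/(@mpoly2_ind R): p => [c|||p q cp cq|p q cp cq].
- rewrite (_ : polyfun _ = cst c); last by apply/funext => y; rewrite polyfunC.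
  exact: measurable_cst.
- rewrite (_ : polyfun _ = fst); last by apply/funext => y; rewrite polyfun_coord0.
  exact: measurable_fst.
- rewrite (_ : polyfun _ = snd); last by apply/funext => y; rewrite polyfun_coord1.
  exact: measurable_snd.
- rewrite (_ : polyfun _ = polyfun p \+ polyfun q); last first.
    by apply/funext => y; rewrite polyfunD.
  exact: measurable_funD.
- rewrite (_ : polyfun _ = polyfun p \* polyfun q); last first.
    by apply/funext => y; rewrite polyfunM.
  exact: measurable_funM.
Qed.

Lemma polyfun_bounded (M : R) p : exists C : R, forall x,
  `|x.1| <= M -> `|x.2| <= M -> `|polyfun p x| <= C.
Proof.
elim/(@mpoly2_ind R): p => [c|||p q [C Cp] [D Dq]|p q [C Cp] [D Dq]].
- by exists `|c| => x _ _; rewrite polyfunC.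
- by exists M => x; rewrite polyfun_coord0.
- by exists M => x; rewrite polyfun_coord1.
- exists (C + D) => x x1 x2; rewrite polyfunD (le_trans (ler_normD _ _))//.
  by rewrite lerD ?Cp ?Dq.
- exists (C * D) => x x1 x2; rewrite polyfunM normrM.
  by rewrite ler_pM ?Cp ?Dq.
Qed.

(** The bridge from algebra to analysis: along a line, the analytic derivative is the formal
    directional derivative. *)
Lemma is_derive_polyfun p (k0 k1 l0 l1 s : R) :
  is_derive s 1 (fun s' => polyfun p (k0 + s' * l0, k1 + s' * l1))
    (polyfun (dird (l0, l1) p) (k0 + s * l0, k1 + s * l1)).
Proof.
have affine k l : is_derive s 1 (fun s' => k + s' * l) l.
  rewrite (_ : (fun _ => _) = cst k + l *: id).
    by apply: is_derive_eq; rewrite add0r /GRing.scale/= mulr1.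
  by apply/funext => y; rewrite [RHS]/= /GRing.scale/= mulrC.
elim/(@mpoly2_ind R): p => [c|||p q cp cq|p q cp cq].
- rewrite dirdC polyfun0 (_ : (fun _ => _) = cst c).
    exact: is_derive_cst.
  by apply/funext => y; rewrite polyfunC.
- rewrite dird_coord0 polyfunC (_ : (fun _ => _) = fun s' => k0 + s' * l0)//.
  by apply/funext => y; rewrite polyfun_coord0.
- rewrite dird_coord1 polyfunC (_ : (fun _ => _) = fun s' => k1 + s' * l1)//.
  by apply/funext => y; rewrite polyfun_coord1.
- rewrite dirdD polyfunD; set F := fun=> _.
  rewrite (_ : F = (fun s' => polyfun p (k0 + s' * l0, k1 + s' * l1)) +
    (fun s' => polyfun q (k0 + s' * l0, k1 + s' * l1))).
    exact: is_deriveD.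
  by apply/funext => y; rewrite /F polyfunD.
- rewrite dirdM polyfunD !polyfunM; set F := fun=> _.
  rewrite (_ : F = (fun s' => polyfun p (k0 + s' * l0, k1 + s' * l1)) *
    (fun s' => polyfun q (k0 + s' * l0, k1 + s' * l1))).
    apply: (is_derive_eq (is_deriveM cp cq)); rewrite /GRing.scale/=. ring.
  by apply/funext => y; rewrite /F polyfunM.
Qed.

Lemma is_derive_polyfun0 p (s t : R) :
  is_derive s 1 (fun s' => polyfun p (s', t)) (polyfun (mderiv ord0 p) (s, t)).
Proof.
have := is_derive_polyfun p 0 t 1 0 s.
rewrite /dird/= scale1r scale0r addr0 mulr1 mulr0 addr0 add0r.
by under eq_fun do rewrite mulr1 mulr0 addr0 add0r.
Qed.

Lemma is_derive_polyfun1 p (s t : R) :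
  is_derive t 1 (fun t' => polyfun p (s, t')) (polyfun (mderiv ord_max p) (s, t)).
Proof.
have := is_derive_polyfun p s 0 0 1 t.
rewrite /dird/= scale1r scale0r add0r mulr1 mulr0 addr0 add0r.
by under eq_fun do rewrite mulr1 mulr0 addr0 add0r.
Qed.

End PolyfunAnalysis.

(** * Closed and open triangles in barycentric coordinates *)

Section Triangle.
Context {R : realType}.
Implicit Types (a b c x y z v : R * R).

Lemma convex_setP (C : set (R * R)) : @convex_set R (R * R)%type C <->
  (forall x y (s t : R), C x -> C y -> 0 <= s -> 0 <= t -> s + t = 1 ->
     C (s *: x + t *: y)).
Proof.
split=> [cC x y s t Cx Cy s0 t0 st1|cC x y l /set_mem Cx /set_mem Cy].
  have s1 : s <= 1 by rewrite -st1 lerDl.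
  have /set_mem := cC x y (Itv01 s0 s1) (mem_set Cx) (mem_set Cy).
  have -> : t = 1 - s by rewrite -st1 addrC addKr.
  by [].
apply: mem_set; apply: cC => //=.
- by rewrite subr_ge0 le1.
- by rewrite addrCA subrr addr0.
Qed.

Lemma barycentric_conv a b c x y (s t : R) : s + t = 1 ->
  barycentric a b c (s *: x + t *: y) =
  s * barycentric a b c x + t * barycentric a b c y.
Proof.
move=> st; rewrite /barycentric !mulrA -mulrDl; congr (_ / _).
have -> : t = 1 - s by rewrite -st addrC addKr.
by rewrite /signed_area2/= /GRing.scale/=; ring.
Qed.

Lemma barycentric_move a b c x (s : R) v :
  barycentric a b c (x + s *: v) = barycentric a b c x +
  s * ((v.1 * (b.2 - c.2) + v.2 * (c.1 - b.1)) / signed_area2 a b c).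
Proof. by rewrite /barycentric /signed_area2/= /GRing.scale/=; ring. Qed.

Section Nondegenerate.
Variables a b c : R * R.
Hypothesis abc : nondegenerate_triangle a b c.

Let D0 : signed_area2 a b c != 0 := abc.

Lemma barycentric_sum x :
  barycentric a b c x + barycentric b c a x + barycentric c a b x = 1.
Proof.
rewrite /barycentric (signed_area2_rot a b c) -(signed_area2_rot c a b).
by rewrite -!mulrDl -[RHS](mulfV D0) /signed_area2; congr (_ / _); ring.
Qed.

Lemma barycentric_decomp x : x = barycentric a b c x *: a +
  barycentric b c a x *: b + barycentric c a b x *: c.
Proof.
rewrite /barycentric (signed_area2_rot a b c) -(signed_area2_rot c a b).
have e (k l m r : R) : r * signed_area2 a b c =
    signed_area2 x b c * k + signed_area2 x c a * l + signed_area2 x a b * m ->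
    r = signed_area2 x b c / signed_area2 a b c * k + signed_area2 x c a /
    signed_area2 a b c * l + signed_area2 x a b / signed_area2 a b c * m.
  by move=> h; apply: (mulIf D0); rewrite h; field.
rewrite [LHS]surjective_pairing [RHS]surjective_pairing /=.
by congr pair; apply: e; rewrite /signed_area2; ring.
Qed.

Lemma barycentric_vertex : [/\ barycentric a b c a = 1,
  barycentric b c a a = 0 & barycentric c a b a = 0].
Proof.
rewrite /barycentric mulfV//; split=> //.
- by rewrite (_ : signed_area2 a c a = 0) ?mul0r// /signed_area2; ring.
- by rewrite (_ : signed_area2 a a b = 0) ?mul0r// /signed_area2; ring.
Qed.

End Nondegenerate.

Lemma nondegenerate_rot a b c :
  nondegenerate_triangle a b c -> nondegenerate_triangle b c a.
Proof. by rewrite /nondegenerate_triangle (signed_area2_rot a). Qed.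

(** The right-hand side is convex and contains the vertices. Conversely, its points are convex
    combinations of the vertices with the barycentric coordinates as weights. *)
Lemma convex_hull_triangle a b c : nondegenerate_triangle a b c ->
  convex_hull [set a; b; c] = [set x | [/\ 0 <= barycentric a b c x,
    0 <= barycentric b c a x & 0 <= barycentric c a b x]].
Proof.
move=> abc; have bca := nondegenerate_rot abc; have cab := nondegenerate_rot bca.
apply/seteqP; split.
  apply: smallest_sub.
    apply/convex_setP => x y s t [x1 x2 x3] [y1 y2 y3] s0 t0 st.
    by split; rewrite barycentric_conv// addr_ge0// mulr_ge0.
  move=> _ [[]|] ->.
  - by have [e1 e2 e3] := barycentric_vertex abc; rewrite /= e1 e2 e3 lexx ler01.
  - by have [e1 e2 e3] := barycentric_vertex bca; rewrite /= e1 e2 e3 lexx ler01.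
  - by have [e1 e2 e3] := barycentric_vertex cab; rewrite /= e1 e2 e3 lexx ler01.
move=> x [x1 x2 x3] C [/convex_setP cC abcC].
have [Ca Cb Cc] : [/\ C a, C b & C c].
  by split; apply: abcC; [left; left|left; right|right].
rewrite (barycentric_decomp abc x).
have xs := barycentric_sum abc x.
set k1 := barycentric a b c x in x1 xs *.
set k2 := barycentric b c a x in x2 xs *.
set k3 := barycentric c a b x in x3 xs *.
(* A ternary combination is obtained from two binary ones by first normalizing the weights of [a]
   and [b]; if these weights add up to zero, the point is [c]. *)
have [k0|k0] := eqVneq (k1 + k2) 0.
  have /andP[/eqP -> /eqP ->] : (k1 == 0) && (k2 == 0) by rewrite -paddr_eq0// k0.
  by rewrite !scale0r !add0r (_ : k3 = 1) ?scale1r// -xs k0 add0r.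
have k0' : 0 < k1 + k2 by rewrite lt_neqAle eq_sym k0 addr_ge0.
have -> : k1 *: a + k2 *: b = (k1 + k2) *: ((k1 / (k1 + k2)) *: a + (k2 / (k1 + k2)) *: b).
  by rewrite scalerDr !scalerA ![(k1 + k2) * _]mulrC !mulfVK.
apply: (cC) => //; last exact: ltW.
apply: cC => //; [exact: divr_ge0 (ltW k0')|exact: divr_ge0 (ltW k0')|].
by rewrite -mulrDl mulfV.
Qed.

(** From an interior point one can move a little in the direction [b' - a'] without leaving the
    hull. The coordinate of [a'] then decreases at unit rate, so it was positive. Conversely, the
    strict inequalities define an open subset of the hull. *)
Lemma open_triangleE a b c : nondegenerate_triangle a b c ->
  open_triangle a b c = [set x | [/\ 0 < barycentric a b c x,
    0 < barycentric b c a x & 0 < barycentric c a b x]].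
Proof.
move=> abc; have bca := nondegenerate_rot abc; have cab := nondegenerate_rot bca.
rewrite /open_triangle convex_hull_triangle//; set C := [set x | _].
apply/seteqP; split=> x.
  have main a' b' c' : nondegenerate_triangle a' b' c' ->
      C `<=` [set y | 0 <= barycentric a' b' c' y] -> interior C x ->
      0 < barycentric a' b' c' x.
    move=> abc' Cpos Cx.
    have xe : x + s *: (b' - a') @[s --> (0 : R)] --> x.
      rewrite -[X in _ --> X]addr0 -(scale0r (b' - a')).
      by apply: cvgD; [exact: cvg_cst|apply: cvgZr_tmp; exact: cvg_id].
    have /nbhs_ballP[e /= e0 He] := xe _ Cx.
    have /Cpos /= : C (x + (e / 2) *: (b' - a')).
      by apply: He; rewrite /ball/= sub0r normrN gtr0_norm ?divr_gt0// ltr_pdivrMr// ltr_pMr// ltr1n.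
    rewrite barycentric_move/= (_ : _ / signed_area2 _ _ _ = -1).
      by rewrite mulrN1 subr_ge0; apply: lt_le_trans; rewrite divr_gt0.
    rewrite -(divff (abc' : signed_area2 _ _ _ != 0)) -mulNr; congr (_ / _).
    by rewrite /signed_area2; ring.
  by move=> Cx; split; apply: main => // y [].
have openb a' b' c' : open [set x | 0 < barycentric a' b' c' x].
  rewrite (_ : [set _ | _] = polyfun (bary_poly a' b' c') @^-1` [set y | 0 < y]).
    by apply: open_comp; [move=> ? _; exact: continuous_polyfun|exact: open_gt].
  by apply/seteqP; split=> y /=; rewrite polyfun_bary.
move=> [x1 x2 x3]; set U := [set x | 0 < barycentric a b c x] `&`
    [set x | 0 < barycentric b c a x] `&` [set x | 0 < barycentric c a b x].
have oU : open U by apply: openI; first exact: openI.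
suff : U `<=` interior C by apply.
by rewrite -open_subsetE// => y [[y1 y2] y3]; split; exact: ltW.
Qed.

End Triangle.

(** * The fundamental theorem of calculus on a bounded open interval *)

Section IntervalIntegral.
Context {R : realType}.
Notation mu := (@lebesgue_measure R).

Lemma closure_inf (S : set R) : S !=set0 -> has_lbound S -> closure S (inf S).
Proof.
move=> S0 lS B /nbhs_ballP[e /= e0 eB].
have [y Sy yi] := inf_adherent e0 (conj S0 lS).
exists y; split => //; apply: eB; rewrite /ball/= distrC ger0_norm.
  by rewrite ltrBlDl.
by rewrite subr_ge0; apply: ge_inf.
Qed.

(** The endpoints [inf S] and [sup S] lie in the closure of [S] but not in [S], so [F] vanishes
    there. Keeping [S] abstract avoids computing the endpoints of the slices of a triangle. *)
Lemma integral_derivative_interval (F f : R -> R) (S : set R) :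
    is_interval S -> open S -> has_lbound S -> has_ubound S ->
    continuous f -> (forall y : R, is_derive y 1 F (f y)) ->
    (forall y, closure S y -> ~ S y -> F y = 0) ->
  (\int[mu]_(y in S) (f y)%:E = 0)%E.
Proof.
move=> iS oS lS uS cf dF F0.
have [->|/set0P S0] := eqVneq S set0; first by rewrite integral_set0.
have SE : S = `]inf S, sup S[%classic.
  rewrite -{1}((interior_id S).1 oS) interval_bounded_interior//.
have is_S : inf S < sup S.
  by case: S0 => y; rewrite {1}SE/= in_itv/= => /andP[iy ys]; exact: lt_trans ys.
have Fi : F (inf S) = 0.
  by apply: F0; [exact: closure_inf|rewrite {1}SE/= in_itv/= ltxx].
have Fs : F (sup S) = 0.
  by apply: F0; [exact: closure_sup|rewrite {1}SE/= in_itv/= ltxx andbF].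
have mf : measurable_fun setT (EFin \o f).
  by apply/measurable_EFinP; exact: continuous_measurable_fun.
have cF : continuous F.
  by move=> y; apply: differentiable_continuous; apply/derivable1_diffP.
rewrite {1}SE integral_itv_bndo_bndc; last exact: measurable_funTS.
rewrite integral_itv_obnd_cbnd; last exact: measurable_funTS.
rewrite (continuous_FTC2 is_S _ _ _ : _ = (F (sup S))%:E - (F (inf S))%:E)%E.
- by rewrite Fi Fs subee.
- exact: continuous_subspaceT.
- split=> [y _//||].
  + exact: cvg_at_right_filter (cF _).
  + exact: cvg_at_left_filter (cF _).
- by move=> y _; rewrite derive1E; apply: derive_val.
Qed.

End IntervalIntegral.

Section TriangleIntegral.
Context {R : realType} (a b c : R * R).
Hypothesis abc : nondegenerate_triangle a b c.
Implicit Types (p q : mpoly 2 R).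
Let K := open_triangle a b c.
Notation mu2 := ((@lebesgue_measure R \x @lebesgue_measure R)%E).

Let mem_KE : K = [set x | [/\ 0 < barycentric a b c x,
  0 < barycentric b c a x & 0 < barycentric c a b x]].
Proof. exact: open_triangleE. Qed.

Lemma measurable_triangle : measurable K.
Proof.
have mb a' b' c' : measurable [set x : R * R | 0 < barycentric a' b' c' x].
  rewrite (_ : [set _ | _] = setT `&` polyfun (bary_poly a' b' c') @^-1` `]0, +oo[%classic).
    exact: measurable_polyfun.
  by rewrite setTI; apply/seteqP; split=> x /=; rewrite polyfun_bary in_itv/= andbT.
rewrite mem_KE (_ : mkset _ = [set x | 0 < barycentric a b c x] `&`
    [set x | 0 < barycentric b c a x] `&` [set x | 0 < barycentric c a b x]).
  by apply: measurableI => //; exact: measurableI.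
by apply/seteqP; split=> x /=; [case|case; case].
Qed.

Lemma triangle_bounded : exists M : R,
  forall x, K x -> `|x.1| <= M /\ `|x.2| <= M.
Proof.
exists (`|a.1| + `|b.1| + `|c.1| + (`|a.2| + `|b.2| + `|c.2|)) => x.
rewrite mem_KE/= => -[x1 x2 x3].
have := barycentric_sum abc x; have := barycentric_decomp abc x.
set k1 := barycentric _ _ _ x in x1 *; set k2 := barycentric _ _ _ x in x2 *.
set k3 := barycentric _ _ _ x in x3 *.
move=> -> ks; rewrite /= /GRing.scale/=.
have e (u v w : R) : `|k1 * u + k2 * v + k3 * w| <= `|u| + `|v| + `|w|.
  rewrite (le_trans (ler_normD _ _))// lerD//.
    rewrite (le_trans (ler_normD _ _))// lerD// normrM.
      by rewrite ger0_norm ?(ltW x1)// ler_piMl// -ks -addrA lerDl addr_ge0// ltW.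
    by rewrite ger0_norm ?(ltW x2)// ler_piMl// -ks addrAC lerDr addr_ge0// ltW.
  by rewrite normrM ger0_norm ?(ltW x3)// ler_piMl// -ks lerDr addr_ge0// ltW.
by split; rewrite (le_trans (e _ _ _))// ?lerDl ?lerDr !addr_ge0.
Qed.

Lemma triangle_measure_fin : (mu2 K < +oo)%E.
Proof.
have [M KM] := triangle_bounded.
have mI : measurable (`[- M, M]%classic : set R) by exact: measurable_itv.
apply: (@le_lt_trans _ _ (mu2 (`[- M, M]%classic `*` `[- M, M]%classic))).
  apply: le_measure.
  - by rewrite inE; exact: measurable_triangle.
  - by rewrite inE; exact: measurableX.
  - by move=> x /KM[x1 x2]; split; rewrite /= in_itv/= -ler_norml.
have Ifin : (@lebesgue_measure R [set` `[- M, M]%R] < +oo)%E.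
  by rewrite lebesgue_measure_itv/=; case: ifPn => _; rewrite ?ltry.
rewrite product_measure1E//; apply: lte_mul_pinfty => //.
by rewrite ge0_fin_numE.
Qed.

Lemma integrable_polyfun p : mu2.-integrable K (EFin \o polyfun p).
Proof.
apply: measurable_bounded_integrable.
- exact: measurable_triangle.
- exact: triangle_measure_fin.
- by apply: measurable_funTS; exact: measurable_polyfun.
have [M KM] := triangle_bounded; have [C Cp] := polyfun_bounded M p.
exists C; split; first exact: num_real.
by move=> D CD x /= /KM[x1 x2]; rewrite (le_trans (Cp x x1 x2))// ltW.
Qed.

End TriangleIntegral.

(** * The divergence theorem for fields multiplied by the bubble *)

Section Divergence.
Context {R : realType} (a b c : R * R).
Hypothesis abc : nondegenerate_triangle a b c.
Implicit Types (p q : mpoly 2 R).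
Let K := open_triangle a b c.
Notation mu := (@lebesgue_measure R).
Notation mu2 := ((@lebesgue_measure R \x @lebesgue_measure R)%E).

Let mem_KE : K = [set x | [/\ 0 < barycentric a b c x,
  0 < barycentric b c a x & 0 < barycentric c a b x]].
Proof. exact: open_triangleE. Qed.

(** The affine map [k] parametrizes a horizontal or vertical line, so that one proof serves both
    variables. The line meets the triangle in a bounded open interval, at whose ends a barycentric
    coordinate, and with it the bubble, is zero. *)
Lemma slice_integral (k : R -> R * R) (g h : mpoly 2 R) :
    continuous k ->
    (forall x y s t : R, s + t = 1 -> k (s * x + t * y) = s *: k x + t *: k y) ->
    (forall y, `|y| <= `|(k y).1| + `|(k y).2|) ->
    (forall y : R, is_derive y 1 (fun y => polyfun (bubble_poly a b c * h) (k y))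
       (polyfun g (k y))) ->
  (\int[mu]_y ((EFin \o polyfun g) \_ K) (k y) = 0)%E.
Proof.
move=> ck ak bk dk; pose S := k @^-1` K.
have -> : (\int[mu]_y ((EFin \o polyfun g) \_ K) (k y) =
    \int[mu]_(y in S) (polyfun g (k y))%:E)%E.
  rewrite [RHS]integral_mkcond; apply: eq_integral => y _.
  rewrite /patch; congr (if _ then _ else _).
have [M KM] := triangle_bounded abc.
have SM y : S y -> `|y| <= M + M.
  by move=> /KM[y1 y2]; rewrite (le_trans (bk y))// lerD.
have cb a' b' c' : continuous (fun y => barycentric a' b' c' (k y)).
  under eq_fun do rewrite -polyfun_bary.
  by move=> y; apply: continuous_comp; [exact: ck|exact: continuous_polyfun].
apply: (integral_derivative_interval _ _ _ _ _ dk).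
- move=> x y Sx Sy t /andP[xt ty].
  have [e|xy] := eqVneq x y.
    by rewrite (_ : t = x)//; apply/eqP; rewrite eq_le xt andbT e.
  have xy' : 0 < y - x by rewrite subr_gt0 lt_neqAle xy (le_trans xt).
  have st : (y - t) / (y - x) + (t - x) / (y - x) = 1.
    by rewrite -mulrDl subrKA divff// gt_eqF.
  have s0 : 0 <= (y - t) / (y - x) by rewrite divr_ge0 ?subr_ge0 ?(le_trans xt ty).
  have t0 : 0 <= (t - x) / (y - x) by rewrite divr_ge0 ?subr_ge0 ?(le_trans xt ty).
  have te : t = (y - t) / (y - x) * x + (t - x) / (y - x) * y.
    by field; rewrite gt_eqF.
  have pos a' b' c' : 0 < barycentric a' b' c' (k x) ->
      0 < barycentric a' b' c' (k y) -> 0 < barycentric a' b' c' (k t).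
    move=> px py; rewrite te ak// barycentric_conv//.
    have [s00|s00] := eqVneq ((y - t) / (y - x)) 0.
      by move: st; rewrite s00 add0r => ->; rewrite mul0r add0r mul1r.
    by apply: ltr_pwDl; [rewrite mulr_gt0// lt_neqAle eq_sym s00|rewrite mulr_ge0// ltW].
  move: Sx Sy; rewrite /S /preimage mem_KE /= => -[x1 x2 x3] [y1 y2 y3].
  by split; exact: pos.
- apply: open_comp; first by move=> y _; exact: ck.
  exact: open_interior.
- by exists (- (M + M)) => y /SM; rewrite ler_norml => /andP[].
- by exists (M + M) => y /SM; rewrite ler_norml => /andP[].
- by move=> y; apply: continuous_comp; [exact: ck|exact: continuous_polyfun].
- move=> y Cy nSy.
  (* On the closure of the slice the coordinates are still nonnegative; if none were zero, the point
     would belong to the slice. *)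
  have nonneg a' b' c' : S `<=` [set y | 0 < barycentric a' b' c' (k y)] ->
      0 <= barycentric a' b' c' (k y).
    move=> Spos; have clo : closed [set y | 0 <= barycentric a' b' c' (k y)].
      by apply: (@closed_comp _ _ _ [set r : R | 0 <= r]) => // ? _; exact: cb.
    have sub : S `<=` [set y | 0 <= barycentric a' b' c' (k y)].
      by move=> u /Spos /ltW.
    by move: (closure_subset sub Cy); rewrite -((closure_id _).1 clo).
  have k1 : 0 <= barycentric a b c (k y).
    by apply: nonneg => u; rewrite /S /preimage mem_KE /= => -[].
  have k2 : 0 <= barycentric b c a (k y).
    by apply: nonneg => u; rewrite /S /preimage mem_KE /= => -[].
  have k3 : 0 <= barycentric c a b (k y).
    by apply: nonneg => u; rewrite /S /preimage mem_KE /= => -[].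
  rewrite polyfunM polyfun_bubble /bubble.
  have [->|e1] := eqVneq (barycentric a b c (k y)) 0; first by rewrite !mul0r.
  have [->|e2] := eqVneq (barycentric b c a (k y)) 0; first by rewrite mulr0 !mul0r.
  have [->|e3] := eqVneq (barycentric c a b (k y)) 0; first by rewrite mulr0 mul0r.
  exfalso; apply: nSy; rewrite /S /preimage mem_KE/=.
  by split; rewrite lt_neqAle eq_sym ?e1 ?e2 ?e3.
Qed.

Definition tri_int p : R := \int[mu2]_(x in K) polyfun p x.

Let integrable_patch p : mu2.-integrable setT ((EFin \o polyfun p) \_ K).
Proof.
refine ((@integrable_mkcond _ _ _ mu2 K _ _).1 _).
  exact: measurable_triangle.
exact: integrable_polyfun.
Qed.

(** After extension by zero to the plane, Fubini's theorem reduces the claim to horizontal slices,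
    each of which contributes zero. *)
Lemma tri_int_mderiv0 h : tri_int (mderiv ord0 (bubble_poly a b c * h)) = 0.
Proof.
rewrite /tri_int /Rintegral integral_mkcond -integral21_prod_meas1; last exact: integrable_patch.
rewrite integral0_eq// => t _; rewrite /fubini_G.
apply: (slice_integral (k := fun s => (s, t)) (h := h)).
- by move=> s; apply: (@cvg_pair _ _ _ _ (nbhs s) (nbhs t)); [exact: cvg_id|exact: cvg_cst].
- move=> x y k l kl; rewrite /GRing.scale/=; congr pair.
  by rewrite /GRing.scale/= -mulrDl kl mul1r.
- by move=> y /=; rewrite lerDl.
- by move=> y; exact: is_derive_polyfun0.
Qed.

Lemma tri_int_mderiv1 h : tri_int (mderiv ord_max (bubble_poly a b c * h)) = 0.
Proof.
rewrite /tri_int /Rintegral integral_mkcond -integral12_prod_meas1; last exact: integrable_patch.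
rewrite integral0_eq// => s _; rewrite /fubini_F.
apply: (slice_integral (k := fun t => (s, t)) (h := h)).
- by move=> t; apply: (@cvg_pair _ _ _ _ (nbhs s) (nbhs t)); [exact: cvg_cst|exact: cvg_id].
- move=> x y k l kl; rewrite /GRing.scale/=; congr pair.
  by rewrite /GRing.scale/= -mulrDl kl mul1r.
- by move=> y /=; rewrite lerDr.
- by move=> y; exact: is_derive_polyfun1.
Qed.

Lemma tri_intD p q : tri_int (p + q) = tri_int p + tri_int q.
Proof.
rewrite /tri_int -RintegralD; [|exact: measurable_triangle|exact: integrable_polyfun..].
by apply: eq_Rintegral => x _; rewrite polyfunD.
Qed.

Lemma tri_intZ k p : tri_int (k *: p) = k * tri_int p.
Proof.
rewrite /tri_int -RintegralZl; [|exact: measurable_triangle|exact: integrable_polyfun].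
by apply: eq_Rintegral => x _; rewrite polyfunZ.
Qed.

Lemma tri_intB p q : tri_int (p - q) = tri_int p - tri_int q.
Proof. by rewrite tri_intD -scaleN1r tri_intZ mulN1r. Qed.

Lemma tri_int_dird v h : tri_int (dird v (bubble_poly a b c * h)) = 0.
Proof.
by rewrite /dird tri_intD !tri_intZ tri_int_mderiv0 tri_int_mderiv1 !mulr0 addr0.
Qed.

End Divergence.

(** * Definiteness of the weighted inner product *)

Section Positivity.
Context {R : realType}.
Implicit Types (p q : mpoly 2 R) (x v : R * R).
Notation mu2 := ((@lebesgue_measure R \x @lebesgue_measure R)%E).

(** On the line through [x] in direction [v], the function is zero near [x], hence so is its
    derivative there. *)
Lemma dird_open_eq0 (U : set (R * R)) v p : open U ->
    (forall x, U x -> polyfun p x = 0) ->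
  forall x, U x -> polyfun (dird v p) x = 0.
Proof.
move=> oU p0 x Ux.
pose k (s : R) : R * R := (x.1 + s * v.1, x.2 + s * v.2).
have k0 : k 0 = x by rewrite /k !mul0r !addr0 -surjective_pairing.
have ck : continuous k.
  have ca (l m : R) : continuous (fun s : R => l + s * m).
    by move=> s; apply: cvgD; [exact: cvg_cst|apply: cvgMl; exact: cvg_id].
  move=> s; apply: (@cvg_pair _ _ _ _ (nbhs (x.1 + s * v.1)) (nbhs (x.2 + s * v.2)));
    exact: ca.
have near0 : \forall s \near (0 : R), polyfun p (k s) = cst 0 s.
  have : nbhs (k 0) U by rewrite k0; exact: open_nbhs_nbhs.
  move=> nU; have : nbhs (0 : R) (k @^-1` U) by exact: ck nU.
  by apply: filterS => s /p0.
have := is_derive_polyfun p x.1 x.2 v.1 v.2 0.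
move/(near_eq_is_derive near0) => d1.
have d0 : is_derive (0 : R) (1 : R) (cst (0 : R) : R -> R) 0 by exact: is_derive_cst.
have := @derive_val _ _ _ _ _ _ _ d1; rewrite (@derive_val _ _ _ _ _ _ _ d0) => e.
by rewrite [RHS]e -[in LHS]k0 /k -surjective_pairing.
Qed.

Lemma polyfun_open_eq0 (U : set (R * R)) p : open U -> U !=set0 ->
  (forall x, U x -> polyfun p x = 0) -> p = 0.
Proof.
move=> oU [x0 Ux0] p0.
apply: (mpoly_eq0_taylor (P := (1, 0)) (Q := (0, 1)) (z := x0)).
  by rewrite /= !mul1r mul0r subr0 oner_eq0.
have it v k q : (forall x, U x -> polyfun q x = 0) ->
    forall x, U x -> polyfun (iter k (dird v) q) x = 0.
  by move=> q0; elim: k => //= k IH; exact: dird_open_eq0.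
by move=> j k; exact: (it _ _ _ (it _ _ _ p0) _ Ux0).
Qed.

Variables a b c : R * R.
Hypothesis abc : nondegenerate_triangle a b c.
Let K := open_triangle a b c.

Lemma triangle_nonempty : K !=set0.
Proof.
(* The centroid, all of whose barycentric coordinates are 1/3. *)
exists (3^-1 *: (a + b + c)); rewrite /K open_triangleE//=.
have e a' b' c' : signed_area2 a' b' c' != 0 ->
    barycentric a' b' c' (3^-1 *: (a' + b' + c')) = 3^-1.
  move=> D0; apply: (mulIf D0); rewrite /barycentric mulfVK//.
  by rewrite /signed_area2/= /GRing.scale/=; field.
have bca := nondegenerate_rot abc; have cab := nondegenerate_rot bca.
split; first by rewrite e// invr_gt0.
  by rewrite -addrA (addrC a) e// invr_gt0.
by rewrite (addrC (a + b)) addrA e// invr_gt0.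
Qed.

Lemma bubble_gt0 x : K x -> 0 < bubble a b c x.
Proof.
rewrite /K open_triangleE// => -[x1 x2 x3].
by apply: mulr_gt0 => //; exact: mulr_gt0.
Qed.

(** By continuity [p] exceeds half its value at [x0] on a small square [B] inside the triangle, and
    the integral is at least [m] times the area of [B]. *)
Lemma tri_int_gt0 p : (forall x, K x -> 0 <= polyfun p x) ->
  (exists2 x, K x & 0 < polyfun p x) -> 0 < tri_int a b c p.
Proof.
move=> p0 [x0 Kx0 px0]; set m := polyfun p x0 / 2.
have m0 : 0 < m by rewrite divr_gt0.
have : nbhs x0 (K `&` polyfun p @^-1` [set r | m < r]).
  apply: filterI; first by apply: open_nbhs_nbhs; split => //; exact: open_interior.
  apply: continuous_polyfun; apply: open_nbhs_nbhs; split; first exact: open_gt.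
  by rewrite /= ltr_pdivrMr// ltr_pMr// ltr1n.
move=> /nbhs_ballP[e /= e0 eU].
pose B : set (R * R) := ball x0.1 e `*` ball x0.2 e.
have BU x : B x -> K x /\ m < polyfun p x by move=> Bx; exact: eU.
have mB : measurable B by apply: measurableX; exact: measurable_ball.
have muB : mu2 B = (e *+ 2 * (e *+ 2))%:E.
  rewrite product_measure1E; [|exact: measurable_ball..].
  by rewrite EFinM; congr (_ * _)%E; apply: lebesgue_measure_ball; exact: ltW.
have mp D : measurable_fun D (EFin \o polyfun p).
  by apply/measurable_EFinP; apply: measurable_funTS; exact: measurable_polyfun.
have : (0 < \int[mu2]_(x in K) (polyfun p x)%:E)%E.
  apply: (@lt_le_trans _ _ (\int[mu2]_(x in B) m%:E)%E).
    have -> : (\int[mu2]_(x in B) m%:E = m%:E * mu2 B)%E by exact: integral_cst.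
    by rewrite muB -EFinM lte_fin !mulr_gt0// pmulrn_lgt0.
  apply: (@le_trans _ _ (\int[mu2]_(x in B) (polyfun p x)%:E)%E).
    apply: ge0_le_integral => //.
    - by move=> x _; rewrite lee_fin ltW.
    - exact: mp.
    - by move=> x /BU[_ /ltW]; rewrite lee_fin.
  apply: ge0_subset_integral => //.
  - exact: measurable_triangle.
  - exact: mp.
  - by move=> x /BU[].
(* As [fine] sends an infinite value to 0, the integral must also be shown finite. *)
rewrite /tri_int /Rintegral => I0; apply: fine_gt0; rewrite I0/=.
rewrite ltey_eq; apply/orP; left; apply: integrable_fin_num.
- exact: measurable_triangle.
- exact: integrable_polyfun.
Qed.

Lemma tri_int_sq_eq0 p : tri_int a b c (p * p * bubble_poly a b c) = 0 -> p = 0.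
Proof.
move=> I0; apply: (polyfun_open_eq0 _ triangle_nonempty) => [|x Kx].
  exact: open_interior.
apply/eqP/negPn/negP => px0; have : 0 < tri_int a b c (p * p * bubble_poly a b c).
  apply: tri_int_gt0.
    move=> y Ky; rewrite polyfunM polyfun_bubble polyfunM.
    by apply: mulr_ge0; [rewrite -expr2 sqr_ge0|exact/ltW/bubble_gt0].
  exists x => //; rewrite polyfunM polyfun_bubble polyfunM mulr_gt0 ?bubble_gt0//.
  by rewrite -expr2 exprn_even_gt0.
by rewrite I0 ltxx.
Qed.

End Positivity.

(** * Orthogonal polynomials of a triangle *)

Section OrthogonalPolynomials.
Context {R : realType} (a b c : R * R).
Hypothesis abc : nondegenerate_triangle a b c.
Implicit Types (u w : mpoly 2 R).
Let P := b - a.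
Let Q := c - a.
Let B := bary_poly b c a.
Let C := bary_poly c a b.

Let D0 : signed_area2 a b c != 0 := abc.

(** The coordinates [B], [C] are dual to the edge vectors [P], [Q]; these four derivatives are what
    the abstract operator requires. *)
Let PB : dird P B = 1.
Proof.
rewrite dird_bary (signed_area2_rot a b c) (_ : _ / _ = 1) ?mpolyC1//.
by rewrite -[RHS](divff D0); congr (_ / _); rewrite /signed_area2/=; ring.
Qed.

Let PC : dird P C = 0.
Proof. by rewrite dird_bary (_ : _ / _ = 0) ?mpolyC0// /P/=; ring. Qed.

Let QB : dird Q B = 0.
Proof. by rewrite dird_bary (_ : _ / _ = 0) ?mpolyC0// /Q/=; ring. Qed.

Let QC : dird Q C = 1.
Proof.
rewrite dird_bary -(signed_area2_rot c a b) (_ : _ / _ = 1) ?mpolyC1//.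
by rewrite -[RHS](divff D0); congr (_ / _); rewrite /signed_area2/=; ring.
Qed.

Definition tri_op := jacobi_op (dird P) (dird Q) B C.

Let bubbleE : bubble_poly a b c = (1 - B - C) * B * C.
Proof. by rewrite /bubble_poly (bary_sum abc). Qed.

(** By Lagrange's identity the two integrands differ by derivatives of polynomials divisible by the
    bubble, whose integrals vanish. *)
Lemma tri_op_selfadjoint u w :
  tri_int a b c (w * tri_op 2 2 0 u * bubble_poly a b c) =
  tri_int a b c (u * tri_op 2 2 0 w * bubble_poly a b c).
Proof.
apply/eqP; rewrite -subr_eq0 -tri_intB//; apply/eqP.
rewrite -mulrBl mulrC bubbleE.
rewrite (jacobi_op_selfadjoint (dirdD P) (dirdD Q) (dirdN P) (dirdN Q) (dirdM P)
  (dirdM Q) (dird_nat P) (dird_nat Q) (dird_comm Q P) PB PC QB QC).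
by rewrite -bubbleE tri_intD// !tri_int_dird// addr0.
Qed.

Lemma tri_eulerE u : euler (dird P) (dird Q) B C u =
  (coord ord0 - mpolyC 2 a.1) * mderiv ord0 u +
  (coord ord_max - mpolyC 2 a.2) * mderiv ord_max u.
Proof.
have areaE : signed_area2 b c a = signed_area2 a b c := signed_area2_rot a b c.
have areaE' : signed_area2 c a b = signed_area2 a b c.
  by rewrite -(signed_area2_rot c a b).
have e0 : P.1 *: B + Q.1 *: C = coord ord0 - mpolyC 2 a.1.
  transitivity (affine_poly (- a.1) 1 0); last first.
    by rewrite /affine_poly scale1r scale0r addr0 mpolyCN addrC.
  rewrite /B /C /bary_poly areaE areaE' !affine_polyZ affine_polyD.
  by congr affine_poly; apply: (mulIf D0); rewrite !mulrA -mulrDl mulfVK//;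
    rewrite /signed_area2/=; ring.
have e1 : P.2 *: B + Q.2 *: C = coord ord_max - mpolyC 2 a.2.
  transitivity (affine_poly (- a.2) 0 1); last first.
    by rewrite /affine_poly scale1r scale0r addr0 mpolyCN addrC.
  rewrite /B /C /bary_poly areaE areaE' !affine_polyZ affine_polyD.
  by congr affine_poly; apply: (mulIf D0); rewrite !mulrA -mulrDl mulfVK//;
    rewrite /signed_area2/=; ring.
by rewrite -e0 -e1 /euler /dird -!mul_mpolyC; ring.
Qed.

Lemma msize_tri_euler u k : (msize u <= k)%N ->
  (msize (euler (dird P) (dird Q) B C u) <= k)%N.
Proof.
case: k => [|k] uk.
  have -> : u = 0 by apply/eqP; rewrite -msize_poly_eq0 -leqn0.
  by rewrite /euler !dird0 !mulr0 addr0 msize0.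
by rewrite /euler msize_add// msize_mul2 ?msize_bary// (msize_dird _ uk).
Qed.

(** On the part of degree [n], E(E + 5) acts as n(n + 5), and the remaining terms of the operator
    lower the degree. *)
Lemma msize_tri_op u n : (msize u <= n.+1)%N ->
  (msize (tri_op 2 2 0 u + (n * (n + 5))%:R * u) <= n)%N.
Proof.
move=> un; set E := euler (dird P) (dird Q) B C.
have Eu : (msize (E u - n%:R * u) <= n)%N.
  by rewrite /E tri_eulerE msize_euler_sub.
have EE : E (E u) - n%:R * E u = E (E u - n%:R * u).
  by rewrite /E /euler !dirdB !dirdM !dird_nat; ring.
(* The factorization E(E + 5) - n(n + 5) = (E + n + 5)(E - n) isolates [E u - n u], which has lower
   degree. *)
have -> : tri_op 2 2 0 u + (n * (n + 5))%:R * u =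
    B * dird P (dird P u) + 2%:R * dird P u +
    (C * dird Q (dird Q u) + 2%:R * dird Q u) -
    (E (E u - n%:R * u) + (n + 5)%:R * (E u - n%:R * u)).
  by rewrite -EE /tri_op /jacobi_op -/E !natrM !natrD; ring.
have dn v : (msize (dird v u) <= n)%N by exact: msize_dird un.
have ddn q v v' : (msize q <= 2)%N -> (msize (q * dird v (dird v' u)) <= n)%N.
  move=> q2; case: (n) dn => [|m] dm; last by rewrite msize_mul2 ?(msize_dird _ (dm _)).
  have := dm v'; rewrite leqn0 msize_poly_eq0 => /eqP ->.
  by rewrite dird0 mulr0 msize0.
apply: msize_sub; last by rewrite msize_add ?msize_nat_mul ?msize_tri_euler.
by rewrite !msize_add ?msize_nat_mul ?ddn ?msize_bary.
Qed.

(** Write L for the operator. The defect r = L u + n(n + 5) u has lower degree, so (u, r) = 0 and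
    (r, r) = (r, L u) = (u, L r). This is zero because L does not raise the degree of [r], and
    definiteness gives r = 0. *)
Lemma tri_op_eigen u n : (msize u <= n.+1)%N ->
    (forall w, (msize w <= n)%N -> tri_int a b c (u * w * bubble_poly a b c) = 0) ->
  tri_op 2 2 0 u = - ((n * (n + 5))%:R * u).
Proof.
move=> un u0; set r := tri_op 2 2 0 u + (n * (n + 5))%:R * u.
suff r0 : r = 0 by apply/eqP; rewrite -addr_eq0 -/r r0.
have rn : (msize r <= n)%N by exact: msize_tri_op.
apply: (tri_int_sq_eq0 abc).
have -> : r * r * bubble_poly a b c = r * tri_op 2 2 0 u * bubble_poly a b c +
    (n * (n + 5))%:R *: (u * r * bubble_poly a b c).
  by rewrite -mul_mpolyC rmorph_nat /r; ring.
rewrite tri_intD// tri_intZ// u0// mulr0 addr0 tri_op_selfadjoint u0//.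
case: n @r un u0 rn => [|n] r un u0 rn.
  move: rn; rewrite leqn0 msize_poly_eq0 => /eqP ->.
  by rewrite /tri_op /jacobi_op /euler !(dird0, mulr0, addr0, subr0) msize0.
have Lr := msize_tri_op rn.
rewrite -(addrK ((n * (n + 5))%:R * r) (tri_op 2 2 0 r)).
by apply: msize_sub; [exact: leqW|exact: msize_nat_mul].
Qed.

(** Apply [j] derivatives along [P] and [k] along [Q] to the eigenvalue equation. The operator keeps
    its form with shifted parameters, and at the vertex only its lower order terms survive. *)
Lemma taylor_recurrence u n j k : (msize u <= n.+1)%N ->
    (forall w, (msize w <= n)%N -> tri_int a b c (u * w * bubble_poly a b c) = 0) ->
  let T j k := polyfun (iter j (dird P) (iter k (dird Q) u)) a in
  (2 + j)%:R * T j.+1 k + (2 + k)%:R * T j k.+1 =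
  (((j + k) * (j + k + 5))%:R - (n * (n + 5))%:R) * T j k.
Proof.
move=> un u0 T.
have := iter_jacobi_op (dirdD P) (dirdD Q) (dirdN P) (dirdN Q) (dirdM P)
  (dirdM Q) (dird_nat P) (dird_nat Q) (dird_comm Q P) PB PC QB QC j k u.
rewrite -/tri_op (tri_op_eigen un u0) -mpolyC_nat mul_mpolyC -scaleNr !dird_iterZ.
move=> /(congr1 (meval (tnth [tuple a.1; a.2]))).
have [_ b0 c0] := barycentric_vertex abc.
rewrite /tri_op (jacobi_op_eval (dird P) (dird Q)); first last.
- by rewrite [LHS]polyfun_bary.
- by rewrite [LHS]polyfun_bary.
rewrite -!/(polyfun _ _) polyfunZ -!iterS => e.
rewrite mulrBl (_ : _ * T j k - _ = ((j + k) * (j + k + 5))%:R * T j k +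
  - (n * (n + 5))%:R * T j k); last by rewrite mulNr.
by rewrite e /T /= -(dird_iter_comm Q P) /polyfun; ring.
Qed.

End OrthogonalPolynomials.

(** * Triangle patches *)

Section CyclicFan.
Context {R : realType}.
Implicit Types v w : R * R.

Definition cross v w : R := v.1 * w.2 - w.1 * v.2.

(** Signs of the coefficients in [fan_relation] are read off from products of determinants. *)
Lemma divr_gt0_mul (x y : R) : x != 0 -> (0 < y / x) = (0 < y * x).
Proof.
move=> x0; rewrite (_ : y / x = y * x * x^-1 ^+ 2); last by field.
by rewrite pmulr_lgt0// exprn_even_gt0//= invr_eq0.
Qed.

Variables (q : nat) (W : nat -> R * R).
Hypothesis q3 : (3 <= q)%N.
Hypothesis Wq : forall k, W (k + q) = W k.
Hypothesis disj : forall (k l : nat) (s t s' t' : R),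
  0 < s -> 0 < t -> 0 < s' -> 0 < t' ->
  s *: W k + t *: W k.+1 = s' *: W l + t' *: W l.+1 -> k = l %[mod q].

(** [d] gives twice the signed areas of the triangles spanned by consecutive vectors; a sign of
    [g k] opposite to that of [d k] expresses that two consecutive triangles together span a reflex
    angle. *)
Let d k := cross (W k) (W k.+1).
Let g k := cross (W k) (W k.+2).
Hypothesis d_neq0 : forall k, d k != 0.

Lemma fan_relation k :
  W k.+2 = - (d k.+1 / d k) *: W k + (g k / d k) *: W k.+1.
Proof.
have e (x y t : R) : d k * x = - d k.+1 * y + g k * t ->
    x = - (d k.+1 / d k) * y + g k / d k * t.
  by move=> h; apply: (mulfI (d_neq0 k)); rewrite h; field; exact: d_neq0.
have /e e1 : d k * (W k.+2).1 = - d k.+1 * (W k).1 + g k * (W k.+1).1.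
  by rewrite /d /g /cross; ring.
have /e e2 : d k * (W k.+2).2 = - d k.+1 * (W k).2 + g k * (W k.+1).2.
  by rewrite /d /g /cross; ring.
by rewrite [LHS]surjective_pairing e1 e2.
Qed.

(** If the orientation changed at [W k.+1], the vectors [W k] and [W k.+2] would lie on the same
    side of it, and the two adjacent cones would overlap near [W k.+1]. *)
Lemma fan_orientation k : 0 < d k * d k.+1.
Proof.
rewrite lt_neqAle eq_sym mulf_neq0 ?d_neq0//= leNgt; apply/negP => dd.
have r0 : 0 < - (d k.+1 / d k).
  by rewrite -mulNr divr_gt0_mul// mulNr oppr_gt0 mulrC.
set r := - _ in r0; set b := g k / d k.
have b0 : 0 < b + (`|b| + 1).
  by have := ler_norm (- b); rewrite normrN => ?; lra.
have m0 : 0 < `|b| + 1 by rewrite ltr_wpDl.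
(* The common point is [W k.+2] plus [|b| + 1] times [W k.+1]; this multiple makes the coefficient
   of [W k.+1] positive in both cones, whatever the sign of [b]. *)
have := @disj k k.+1 r (b + (`|b| + 1)) (`|b| + 1) 1 r0 b0 m0 ltr01.
rewrite scale1r fan_relation -/r -/b scalerDl addrA addrC => /(_ erefl).
rewrite -addn1 => /eqP; rewrite -[X in X == _ %[mod q]]addn0 eqn_modDl.
by rewrite mod0n modn_small// (leq_trans _ q3).
Qed.

Lemma fan_same_sign k : 0 < d 0 * d k.
Proof.
elim: k => [|k IH]; first by rewrite -expr2 exprn_even_gt0 ?d_neq0.
have : 0 < (d 0 * d k) * (d k * d k.+1) by rewrite mulr_gt0// fan_orientation.
rewrite (_ : _ * _ = d 0 * d k.+1 * d k ^+ 2); last by ring.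
by rewrite pmulr_lgt0// exprn_even_gt0 ?d_neq0.
Qed.

(* If both turns are obtuse then - W 2 lies in the cone of W 0, W 1 as well as
   in the cone of W 3, W 4. *)
Lemma fan_reflex : g 0 * d 0 < 0 -> g 2 * d 2 < 0 -> q = 3%N.
Proof.
move=> g0 g2.
have a1 : 0 < d 1 / d 0 by rewrite divr_gt0_mul// mulrC fan_orientation.
have a2 : 0 < - (g 0 / d 0) by rewrite -mulNr divr_gt0_mul// mulNr oppr_gt0.
have a3 : 0 < d 3 / d 2 by rewrite divr_gt0_mul// mulrC fan_orientation.
have a4 : 0 < - (g 2 / d 2) by rewrite -mulNr divr_gt0_mul// mulNr oppr_gt0.
have a3V : 0 < (d 3 / d 2)^-1 by rewrite invr_gt0.
have := @disj 0 3 _ _ _ _ a1 a2 (mulr_gt0 a3V a4) a3V.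
have e0 := fan_relation 0; have e2 := fan_relation 2.
have -> : d 1 / d 0 *: W 0 + - (g 0 / d 0) *: W 1 = - W 2.
  by rewrite e0 opprD -!scaleNr opprK.
have -> : (d 3 / d 2)^-1 * - (g 2 / d 2) *: W 3 + (d 3 / d 2)^-1 *: W 4 = - W 2.
  rewrite e2 scalerDr !scalerA !mulrN mulVf ?gt_eqF// scaleN1r scaleNr.
  by rewrite addrCA addNr addr0.
move=> /(_ erefl); rewrite mod0n => /esym/eqP/dvdn_leq; lia.
Qed.

(** The hypothesis makes [e] periodic with period 2, and [fan_relation] then ties [e 0] to [e 1], so
    that both vanish or neither does. Nonzero values of equal sign would put the fan into a half
    plane; values of opposite sign force q = 3, whose odd period is incompatible with alternating
    signs. *)
Lemma fan_linear_eq0 (l1 l2 C : R) :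
  let e k := l1 * (W k).1 + l2 * (W k).2 in
  (forall k, e k + e k.+1 = C) -> forall k, e k = 0.
Proof.
move=> e eC.
have e2 k : e k.+2 = e k by apply: (addIr (e k.+1)); rewrite eC addrC eC.
have rel k : (d k + d k.+1) * e k = g k * e k.+1.
  have : d k * e k.+2 = - d k.+1 * e k + g k * e k.+1.
    by rewrite /e /d /g /cross; ring.
  by rewrite e2 => h; rewrite mulrDl h; ring.
have ds k : 0 < d 0 * (d k + d k.+1).
  by rewrite mulrDr addr_gt0// fan_same_sign.
have dn k : d k + d k.+1 != 0.
  by apply: contraTneq (ds k) => ->; rewrite mulr0 ltxx.
have rel0 := rel 0; have rel1 := rel 1; rewrite e2 in rel1.
have parity k : e k = e 0 \/ e k = e 1.
  suff [] : (e k = e 0 /\ e k.+1 = e 1) \/ (e k = e 1 /\ e k.+1 = e 0).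
  - by case; left.
  - by case; right.
  elim: k => [|k [[IH0 IH1]|[IH0 IH1]]]; first by left.
  - by right; rewrite e2 IH0 IH1.
  - by left; rewrite e2 IH0 IH1.
have [v0|v0] := eqVneq (e 0) 0.
  have w0 : e 1 = 0.
    by apply/eqP; move/eqP: rel1; rewrite v0 mulr0 mulf_eq0 (negPf (dn 1)).
  by move=> k; have [->|->] := parity k.
have [w0|w0] := eqVneq (e 1) 0.
  by move/eqP: rel0; rewrite w0 mulr0 mulf_eq0 (negPf (dn 0)) (negPf v0).
have prod k : e k * e k.+1 = e 0 * e 1.
  elim: k => // k IH; by rewrite e2 mulrC IH.
have en0 k : e k != 0 by have [->|->] := parity k.
exfalso.
have [vw|vw|/eqP vw] := ltgtP (e 0 * e 1) 0; last first.
- by move: vw; rewrite mulf_eq0 (negPf v0) (negPf w0).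
(* All W k lie in one half plane, where the slopes l k would be strictly
   monotone around the fan. *)
- pose l k := (- l2 * (W k).1 + l1 * (W k).2) / e k.
  have lS k : 0 < d 0 * (l k.+1 - l k).
    have -> : l k.+1 - l k = (l1 ^+ 2 + l2 ^+ 2) * d k / (e k * e k.+1).
      rewrite /l; have := en0 k; have := en0 k.+1.
      by rewrite /e /d /cross => ? ?; field; apply/andP.
    rewrite prod !mulrA divr_gt0// -mulrA mulrCA mulr_gt0// ?fan_same_sign//.
    rewrite lt_neqAle eq_sym addr_ge0 ?sqr_ge0// andbT paddr_eq0 ?sqr_ge0//.
    rewrite !sqrf_eq0; apply: contraNN v0 => /andP[/eqP l10 /eqP l20].
    by rewrite /e l10 l20 !mul0r addr0.
  (* The sum of positive increments telescopes to zero, since [W] returns to its start after [q]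
     steps. *)
  have : 0 < \sum_(0 <= k < q) d 0 * (l k.+1 - l k).
    rewrite -(prednK (ltnW (ltnW q3))) big_nat_recr//= ltr_wpDl//.
    by apply: sumr_ge0 => k _; exact: ltW.
  rewrite -mulr_sumr telescope_sumr// /l /e -{1}(add0n q) !Wq.
  by rewrite subrr mulr0 ltxx.
(* Multiplying [rel] by [e k] shows that [g k] has the sign of [d k + d k.+1] times the negative
   number [e k * e k.+1]. *)
- have gneg k : g k * d k < 0.
    have : 0 < (d 0 * (d k + d k.+1)) * (d 0 * d k) * e k ^+ 2.
      apply: mulr_gt0; last by rewrite exprn_even_gt0//= en0.
      by apply: mulr_gt0; [exact: ds|exact: fan_same_sign].
    rewrite (_ : _ * _ = (d 0 ^+ 2 * (d k * (e k * ((d k + d k.+1) * e k))))); last by ring.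
    rewrite rel (_ : _ * (g k * _) = (e k * e k.+1) * g k); last by ring.
    rewrite prod pmulr_rgt0 ?exprn_even_gt0 ?d_neq0// mulrCA nmulr_rgt0//.
    by rewrite mulrC.
  have q_3 := fan_reflex (gneg 0) (gneg 2).
  have e3 : e 3 = e 0 by rewrite /e -(Wq 0) q_3.
  rewrite e2 in e3.
  by move: vw; rewrite e3 -expr2 ltNge sqr_ge0.
Qed.

(** All consecutive pairs of triangles are reflex, so q = 3 and [g k = - d k.+2]. The sum of the
    three relations is m (d 0 + d 1 + d 2) = 0, although the three areas have the same sign. *)
Lemma fan_obtuse_false (m : R) : 0 < m ->
  (forall k, 2 * g k = - (m + 1) * (d k + d k.+1)) -> False.
Proof.
move=> m0 gE.
have gneg k : g k * d k < 0.
  rewrite -(pmulr_rlt0 _ (ltr0n R 2)) mulrA gE -mulrA mulNr oppr_lt0.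
  rewrite mulr_gt0 ?addr_gt0// mulrDl addr_gt0//.
    by rewrite -expr2 exprn_even_gt0// d_neq0.
  by rewrite mulrC fan_orientation.
have q_3 := fan_reflex (gneg 0) (gneg 2).
have W3 k : W k.+3 = W k by rewrite -[RHS]Wq q_3 addn3.
have gd k : g k = - d k.+2 by rewrite /g /d W3 /cross; ring.
have := fan_same_sign 1; have := fan_same_sign 2.
have := gE 0; have := gE 1; have := gE 2; rewrite !gd.
have -> : d 3 = d 0 by rewrite /d !W3.
have -> : d 4 = d 1 by rewrite /d !W3.
move=> h2 h1 h0 p2 p1.
have : m * (d 0 + d 1 + d 2) = 0 by lra.
move=> /eqP; rewrite mulf_eq0 gt_eqF//= => /eqP s0.
have : 0 < d 0 * (d 0 + d 1 + d 2).
  by have p0 := fan_same_sign 0; nra.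
by rewrite s0 mulr0 ltxx.
Qed.

End CyclicFan.

(** * Vanishing of a polynomial orthogonal on every triangle of a patch *)

Section Patch.
Context {R : realType}.

Lemma cone_triangle (z a b : R * R) (s t : R) : nondegenerate_triangle z a b ->
  0 < s -> 0 < t -> s + t < 1 ->
  open_triangle z a b (z + (s *: (a - z) + t *: (b - z))).
Proof.
move=> zab s0 t0 st; rewrite open_triangleE//=.
have D0 : signed_area2 z a b != 0 := zab.
have e1 : barycentric a b z (z + (s *: (a - z) + t *: (b - z))) = s.
  apply: (mulIf D0); rewrite /barycentric (signed_area2_rot z a b) mulfVK//.
  by rewrite /signed_area2/= /GRing.scale/=; ring.
have e2 : barycentric b z a (z + (s *: (a - z) + t *: (b - z))) = t.
  apply: (mulIf D0); rewrite /barycentric -(signed_area2_rot b z a) mulfVK//.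
  by rewrite /signed_area2/= /GRing.scale/=; ring.
have := barycentric_sum zab (z + (s *: (a - z) + t *: (b - z))).
rewrite e1 e2 => e; split=> //; lra.
Qed.

Variables (z : R * R) (q : nat) (A : 'I_q -> R * R) (n : nat).
Hypothesis hT : triangle_patch z A.
Hypothesis n1 : (1 <= n)%N.

Let q3 : (3 <= q)%N := patch_ge3 hT.
Let i0 : 'I_q := Ordinal (ltnW (ltnW q3)).
(** The cyclic index is unrolled to a natural number; [W k] and [W k.+1] are the edges at [z] of the
    triangle with index [iter k.+1 (@ordS q) i0]. *)
Let W k : R * R := A (iter k (@ordS q) i0) - z.

Let iter_ordS k : iter k (@ordS q) i0 = (k %% q)%N :> nat.
Proof. by elim: k => [|k IH]; rewrite ?mod0n//= IH -[(k %% q).+1]addn1 modnDml addn1. Qed.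

Let W_periodic k : W (k + q) = W k.
Proof.
by rewrite /W; congr (A _ - z); apply: val_inj; rewrite /= !iter_ordS modnDr.
Qed.

Let triangle k : nondegenerate_triangle z (A (iter k (@ordS q) i0))
  (A (iter k.+1 (@ordS q) i0)).
Proof. by have := patch_nondegenerate hT (iter k.+1 (@ordS q) i0); rewrite /= ordSK. Qed.

(** A direction common to two open cones, scaled down sufficiently, gives a point common to two
    triangles. *)
Let W_disjoint (k l : nat) (s t s' t' : R) :
  0 < s -> 0 < t -> 0 < s' -> 0 < t' ->
  s *: W k + t *: W k.+1 = s' *: W l + t' *: W l.+1 -> k = l %[mod q].
Proof.
move=> s0 t0 s'0 t'0 e; apply/eqP; rewrite -(eqn_modDr 1) !addn1 -!iter_ordS.
apply/eqP/(congr1 val)/eqP/negPn/negP => kl.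
have : Ktri z A (iter k.+1 (@ordS q) i0) `&` Ktri z A (iter l.+1 (@ordS q) i0) = set0.
  exact: (patch_disjoint hT).
rewrite /Ktri /= !ordSK => /seteqP[+ _].
(* Large enough that after division by [m] both pairs of coefficients have sum less than 1. *)
pose m := 1 + s + t + s' + t'.
have m0 : 0 < m by rewrite /m !addr_gt0.
pose x := z + m^-1 *: (s *: W k + t *: W k.+1).
have mlt (s1 t1 : R) : s1 + t1 < m -> m^-1 * s1 + m^-1 * t1 < 1.
  by move=> h; rewrite -mulrDr mulrC ltr_pdivrMr// mul1r.
move=> /(_ x); apply; split.
  rewrite /x scalerDr !scalerA; apply: cone_triangle => //.
  - by rewrite mulr_gt0 ?invr_gt0.
  - by rewrite mulr_gt0 ?invr_gt0.
  - by apply: mlt; rewrite /m; lra.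
rewrite /x e scalerDr !scalerA; apply: cone_triangle => //.
- by rewrite mulr_gt0 ?invr_gt0.
- by rewrite mulr_gt0 ?invr_gt0.
- by apply: mlt; rewrite /m; lra.
Qed.

Let d k := cross (W k) (W k.+1).
Let g k := cross (W k) (W k.+2).

Let d_neq0 k : d k != 0.
Proof.
by have := triangle k; rewrite /nondegenerate_triangle /signed_area2 /d /cross /W/=.
Qed.

Lemma orthogonal_on_patch_eq0 (u : mpoly 2 R) : (msize u <= n.+1)%N ->
    (forall i w, (msize w <= n)%N ->
       tri_int z (A (ord_pred i)) (A i) (u * w * bubble_poly z (A (ord_pred i)) (A i)) = 0) ->
  u = 0.
Proof.
move=> un orth.
pose T k i j := polyfun (iter i (dird (W k)) (iter j (dird (W k.+1)) u)) z.
have rec k i j : (2 + i)%:R * T k i.+1 j + (2 + j)%:R * T k i j.+1 =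
    (((i + j) * (i + j + 5))%:R - (n * (n + 5))%:R) * T k i j.
  apply: (taylor_recurrence (triangle k) i j un) => w wn.
  by have := orth (iter k.+1 (@ordS q) i0) w wn; rewrite /= ordSK.
have T00 k : T k 0%N 0%N = polyfun u z by [].
have n5 : (n * (n + 5))%:R != 0 :> R.
  by rewrite pnatr_eq0 muln_eq0 addn_eq0 andbF orbF -lt0n.
have uz0 : polyfun u z = 0.
  pose l1 := polyfun (mderiv ord0 u) z; pose l2 := polyfun (mderiv ord_max u) z.
  (* The recurrence of order 0 states that these derivatives have the same sum [C] on any two
     consecutive edges. *)
  have eE k : polyfun (dird (W k) u) z = l1 * (W k).1 + l2 * (W k).2.
    by rewrite /dird polyfunD !polyfunZ mulrC [X in _ + X]mulrC.
  pose C := - (n * (n + 5))%:R * polyfun u z / 2.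
  have eC k : (l1 * (W k).1 + l2 * (W k).2) + (l1 * (W k.+1).1 + l2 * (W k.+1).2) = C.
    have := rec k 0%N 0%N; rewrite /T /= !eE /C mul0n.
    by move=> h; apply: (mulfI (_ : 2 != 0 :> R)); [|rewrite mulrDr h; field].
  have e0 := fan_linear_eq0 q3 W_periodic W_disjoint d_neq0 eC.
  move: (eC 0%N); rewrite !e0 addr0 /C => /esym/eqP.
  by rewrite !mulf_eq0 invr_eq0 oppr_eq0 (negPf n5) pnatr_eq0 orbF => /eqP.
suff T0 m : forall k i j, (i + j)%N = m -> T k i j = 0.
  apply: (@mpoly_eq0_taylor _ (W 0) (W 1) z).
    exact: d_neq0 0%N.
  by move=> j k; exact: (T0 _ 0%N j k erefl).
elim/ltn_ind: m => -[|m] IH k i j.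
  by case: i j => [|//] [|//] _; rewrite T00.
have rec0 k' i' j' : (i' + j')%N = m ->
    (2 + i')%:R * T k' i'.+1 j' + (2 + j')%:R * T k' i' j'.+1 = 0.
  by move=> ij; rewrite rec (IH m) ?mulr0.
(* With order [m] already zero, the recurrence makes neighbouring derivatives of order [m.+1] in one
   triangle nonzero multiples of each other. *)
have propagate k' : T k' 0%N m.+1 = 0 ->
    forall i' j', (i' + j')%N = m.+1 -> T k' i' j' = 0.
  move=> T0; elim=> [|i' IHi] j' ij; first by rewrite -T0 -ij.
  have := rec0 k' i' j' (eq_add_S _ _ ij); rewrite IHi; last by rewrite addnS.
  by rewrite mulr0 addr0 => /eqP; rewrite mulf_eq0 pnatr_eq0/= => /eqP.
(* The pure derivative along an edge belongs to both adjacent triangles and so carries information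
   from one to the next. *)
pose e l := T l m.+1 0%N.
have eS l : T l 0%N m.+1 = e l.+1 by [].
have [[k0 ek0]|ne] := pselect (exists l, e l = 0).
  have down l l' : e (l + l')%N = 0 -> e l = 0.
    elim: l' => [|l' IHl]; first by rewrite addn0.
    by rewrite addnS -eS => h; apply: IHl; rewrite /e (propagate _ h)// addn0.
  have e0 : e 0%N = 0 by exact: (down 0%N k0).
  (* Vanishing passes only to smaller indices; periodicity supplies zeros of arbitrarily large index
     from which to descend. *)
  have eper l : e (l * q)%N = 0.
    elim: l => [//|l IHl]; rewrite mulSn addnC.
    by move: IHl; rewrite /e /T W_periodic.
  have eall l : e l = 0.
    by apply: (down l (l * q - l)%N); rewrite subnKC// leq_pmulr// (ltnW (ltnW q3)).
  by move=> ijm; apply: propagate ijm; rewrite eS eall.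
exfalso; apply: (fan_obtuse_false q3 W_periodic W_disjoint d_neq0 (ltr0Sn R m)) => l.
have el : e l.+1 != 0 by apply/eqP => el; apply: ne; exists l.+1.
have h1 := rec0 l 0%N m (add0n m); have h2 := rec0 l.+1 m 0%N (addn0 m).
rewrite eS in h1; rewrite -/(e l.+1) in h2.
(* [fan_relation] expresses the derivative along [W l.+2] through those along [W l.+1] and [W l].
   Inserting the recurrences [h1] and [h2] and cancelling [e l.+1] leaves the relation on
   determinants, with the order [m.+1] as parameter. *)
have h3 : d l * T l.+1 m 1%N = g l * e l.+1 - d l.+1 * T l 1%N m.
  have rel : d l *: W l.+2 = g l *: W l.+1 - d l.+1 *: W l.
    have r1 : d l * (W l.+2).1 = g l * (W l.+1).1 - d l.+1 * (W l).1.
      by rewrite /d /g /cross; ring.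
    have r2 : d l * (W l.+2).2 = g l * (W l.+1).2 - d l.+1 * (W l).2.
      by rewrite /d /g /cross; ring.
    by congr pair.
  rewrite /e /T [iter 1 _ _]/= [iter 0 _ _]/= -polyfunZ -dird_iterZ -dird_scale rel.
  rewrite dird_lin !dird_scale dird_iterB polyfunB !dird_iterZ !polyfunZ.
  by rewrite -iterSr -dird_iter_comm.
rewrite -/(g l) -/(d l) -/(d l.+1).
apply: (mulfI el); apply/eqP; rewrite -subr_eq0; apply/eqP.
rewrite !natrD in h1 h2.
transitivity (2 * (d l * T l.+1 m 1%N) + (2 + m%:R) * e l.+1 * d l +
    d l.+1 * (2 * T l 1%N m + (2 + m%:R) * e l.+1)).
  by rewrite h3 -natr1; ring.
transitivity (d l * ((2 + m%:R) * e l.+1 + 2 * T l.+1 m 1%N) +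
    d l.+1 * (2 * T l 1%N m + (2 + m%:R) * e l.+1)); first by ring.
by rewrite -[X in X * T l 1%N m]addr0 h1 -[X in X * T l.+1 m 1%N]addr0 h2 !mulr0 addr0.
Qed.

End Patch.

(** * Piecewise polynomials *)

Section Projection.
Context {R : realType} (a b c : R * R).
Hypothesis abc : nondegenerate_triangle a b c.
Implicit Types (p v w : mpoly 2 R).

Lemma tri_int_sum (I : Type) (r : seq I) (F : I -> mpoly 2 R) :
  tri_int a b c (\sum_(i <- r) F i) = \sum_(i <- r) tri_int a b c (F i).
Proof.
elim/big_rec2: _ => [|i y1 y2 _ <-]; last by rewrite tri_intD.
by rewrite -(scale0r (1 : mpoly 2 R)) tri_intZ// mul0r.
Qed.

Lemma ip_triangleE (f g : R * R -> R) p w :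
    (forall x, open_triangle a b c x -> f x = polyfun p x) ->
    (forall x, open_triangle a b c x -> g x = polyfun w x) ->
  ip_triangle a b c f g = tri_int a b c (p * w * bubble_poly a b c).
Proof.
move=> fp gw; apply: eq_Rintegral => x /set_mem Kx.
by rewrite fp// gw// !polyfunM -polyfunM !polyfun_bary.
Qed.

(** The Gram matrix of the monomials of degree below [n] is invertible because the inner product is
    definite; [v] solves the normal equations. *)
Lemma triangle_projection n p : exists2 v, (msize v <= n)%N &
  forall w, (msize w <= n)%N ->
    tri_int a b c ((p - v) * w * bubble_poly a b c) = 0.
Proof.
pose N := #|{: bmultinom 2 n}|; pose om := bubble_poly a b c.
pose e (i : 'I_N) := mpolyX R (bmnm (enum_val i)).
pose comb (x : 'rV[R]_N) : mpoly 2 R := \sum_i x ord0 i *: e i.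
have combE w : (msize w <= n)%N -> w = comb (\row_i mcoeff (bmnm (enum_val i)) w).
  move=> wn; rewrite [LHS](mpolywE wn) /comb.
  rewrite (reindex_omap enum_val (fun m => Some (enum_rank m)))/=; last first.
    by move=> m _; rewrite enum_rankK.
  apply: eq_big => [i|i _]; first by rewrite enum_valK eqxx.
  by rewrite mxE.
have comb_size x : (msize (comb x) <= n)%N.
  rewrite /comb; elim/big_ind: _ => [|r s|i _]; first by rewrite msize0.
    exact: msize_add.
  by rewrite msize_scale// msizeX; case: (enum_val i).
have comb_coef x i : mcoeff (bmnm (enum_val i)) (comb x) = x ord0 i.
  rewrite /comb raddf_sum/= (bigD1 i)//= big1 => [|j ji].
    by rewrite mcoeffZ mcoeffX eqxx mulr1 addr0.
  rewrite mcoeffZ mcoeffX (_ : _ == _ = false) ?mulr0//.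
  by apply: contra_neqF ji => /eqP/val_inj/enum_val_inj.
pose G : 'M[R]_N := \matrix_(i, j) tri_int a b c (e i * e j * om).
have combM p' x : tri_int a b c (p' * comb x * om) =
    \sum_j x ord0 j * tri_int a b c (p' * e j * om).
  rewrite /comb mulr_sumr mulr_suml tri_int_sum; apply: eq_bigr => j _.
  by rewrite -scalerAr -scalerAl tri_intZ.
have GE x j : (x *m G) ord0 j = tri_int a b c (comb x * e j * om).
  rewrite (mulrC (comb x)) combM mxE; apply: eq_bigr => i _.
  by rewrite mxE [e j * _]mulrC.
have G_unit : G \in unitmx.
  rewrite -row_free_unit; apply: inj_row_free => x xG.
  suff x0 : comb x = 0.
    by apply/rowP => i; rewrite mxE -comb_coef x0 mcoeff0.
  apply: (tri_int_sq_eq0 abc); rewrite combM big1// => j _.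
  by rewrite -GE xG mxE mulr0.
pose bv : 'rV[R]_N := \row_j tri_int a b c (p * e j * om).
exists (comb (bv *m invmx G)) => // w /combE ->.
rewrite combM big1// => j _; rewrite !mulrBl tri_intB// -GE mulmxKV//.
by rewrite [bv _ _]mxE subrr mulr0.
Qed.

End Projection.

Section PiecewisePolynomials.
Context {R : realType} (z : R * R) (q : nat) (A : 'I_q -> R * R).
Hypothesis hT : triangle_patch z A.
Implicit Types (f g u : R * R -> R) (v : 'I_q -> mpoly 2 R).
Let K i := Ktri z A i.
Let om i := bubble_poly z (A (ord_pred i)) (A i).
Let J i := tri_int z (A (ord_pred i)) (A i).
Let nd i : nondegenerate_triangle z (A (ord_pred i)) (A i) :=
  patch_nondegenerate hT i.

Lemma Ktri_inj i j x : K i x -> K j x -> i = j.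
Proof.
move=> Kix Kjx; apply/eqP/negPn/negP => /(patch_disjoint hT) /seteqP[+ _].
by move=> /(_ x); apply.
Qed.

(** An open triangle contains none of its own boundary points, and a boundary point of another
    triangle inside it would make the two triangles intersect. *)
Lemma Ktri_sub_regular i : K i `<=` Omega z A `\` skeleton z A.
Proof.
have oK j : open (K j) by exact: open_interior.
move=> x Kix; split.
  suff : K i `<=` Omega z A by apply.
  rewrite /Omega -open_subsetE// => y Ky; exists i => //.
  exact: subset_closure.
move=> [_ [j _ [cj nj]]]; have [e|ij] := eqVneq i j.
  by apply: nj; rewrite -e (interior_id _).1.
have [y [Kjy Kiy]] := cj _ (open_nbhs_nbhs (conj (oK i) Kix)).
by move: ij; rewrite (Ktri_inj Kiy Kjy) eqxx.
Qed.

Definition piecewise v : R * R -> R :=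
  fun x => \sum_i (polyfun (v i) \_ (K i)) x.

Lemma piecewiseE v i x : K i x -> piecewise v x = polyfun (v i) x.
Proof.
move=> Kx; rewrite /piecewise (bigD1 i)//= big1 => [|j ji].
  by rewrite addr0 patchT// inE.
by rewrite patchN//; apply: contra ji => /set_mem Kj; apply/eqP; exact: Ktri_inj Kj Kx.
Qed.

Lemma piecewise_PspaceT n v : (forall i, degree_le n (v i)) ->
  PspaceT n z A (piecewise v).
Proof.
move=> vn; split.
  apply/funext => x; rewrite /patch; case: ifPn => // /negP xO.
  rewrite /piecewise big1// => i _; rewrite patchN//; apply/negP => /set_mem Kx.
  by apply: xO; apply/mem_set; exact: Ktri_sub_regular Kx.
move=> i; exists (v i); first exact: vn.
apply/funext => x; rewrite /patch; case: ifPn => // /set_mem Kx.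
by rewrite (piecewiseE _ Kx).
Qed.

Lemma PspaceT_piecewise n f : PspaceT n z A f ->
  exists2 v, (forall i, degree_le n (v i)) &
    forall i x, K i x -> f x = polyfun (v i) x.
Proof.
move=> [_ fP].
have /choice[v vP] i : exists p, degree_le n p /\ polyfun p \_ (K i) = f \_ (K i).
  by have [p pn pf] := fP i; exists p.
exists v => [i|i x Kx]; first exact: (vP i).1.
by have /(congr1 (@^~ x)) := (vP i).2; rewrite /patch mem_set.
Qed.

Lemma ip_patchE f g v w :
    (forall i x, K i x -> f x = polyfun (v i) x) ->
    (forall i x, K i x -> g x = polyfun (w i) x) ->
  ip_patch z A f g = \sum_i J i (v i * w i * om i).
Proof.
move=> fv gw; apply: eq_bigr => i _; apply: ip_triangleE => x Kx.
- exact: fv.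
- exact: gw.
Qed.

(** Test functions may jump across edges, so one that equals [p] on [K i] and zero on the other
    triangles isolates the condition on [K i]. *)
Lemma ip_patch_local n f v : (0 < n)%N ->
    (forall i x, K i x -> f x = polyfun (v i) x) ->
    (forall w, PspaceT n.-1 z A w -> ip_patch z A f w = 0) ->
  forall i p, (msize p <= n)%N -> J i (v i * p * om i) = 0.
Proof.
move=> n0 fv f0 i p pn; pose w j : mpoly 2 R := if j == i then p else 0.
have wn j : degree_le n.-1 (w j).
  by rewrite /degree_le prednK// /w; case: eqP => _ //; rewrite msize0.
have := f0 _ (piecewise_PspaceT wn).
rewrite (ip_patchE fv (fun j x => @piecewiseE w j x)) (bigD1 i)//= big1.
  by rewrite addr0 /w eqxx.
move=> j ji; rewrite /w (negPf ji) mulr0 mul0r.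
by rewrite -(scale0r (1 : mpoly 2 R)) /J tri_intZ ?mul0r.
Qed.

(** The choice by [xget] is meaningful only if a projection exists; one is assembled from the
    projections on the single triangles. *)
Lemma orth_proj_spec n p (u := polyfun p \_ (Omega z A `\` skeleton z A)) :
  PspaceT n z A (orth_proj n z A u) /\
  forall w, PspaceT n z A w -> ip_patch z A (u - orth_proj n z A u) w = 0.
Proof.
apply: (@xgetPex _ _ [set v | PspaceT n z A v /\
  forall w, PspaceT n z A w -> ip_patch z A (u - v) w = 0]).
have /choice[v vP] i : exists r, (msize r <= n.+1)%N /\ forall w,
    (msize w <= n.+1)%N -> J i ((p - r) * w * om i) = 0.
  by have [r] := triangle_projection (nd i) n.+1 p; exists r.
exists (piecewise v); split.
  by apply: piecewise_PspaceT => i; exact: (vP i).1.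
move=> w /PspaceT_piecewise[w' w'n w'E].
rewrite (@ip_patchE _ _ (fun i => p - v i) w')//.
  by rewrite big1// => i _; exact: (vP i).2 (w'n i).
move=> i x Kx; rewrite polyfunB -(piecewiseE v Kx) /u; congr (_ - _).
by rewrite patchT// inE; exact: Ktri_sub_regular Kx.
Qed.

Lemma patch_orthogonal_eq0 n f p : (0 < n)%N -> (msize p <= n.+1)%N ->
    (forall i x, K i x -> f x = polyfun p x) ->
    (forall w, PspaceT n.-1 z A w -> ip_patch z A f w = 0) ->
  p = 0.
Proof.
move=> n0 pn fp f0; apply: (orthogonal_on_patch_eq0 hT n0 pn) => i w wn.
exact: (ip_patch_local (v := fun=> p) n0 fp f0).
Qed.

Lemma restrict_regular p :
  (polyfun p \_ (Omega z A)) \_ (Omega z A `\` skeleton z A) =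
  polyfun p \_ (Omega z A `\` skeleton z A).
Proof.
apply/funext => x; rewrite /patch; case: ifPn => // /set_mem[Ox _].
by rewrite mem_set.
Qed.

Lemma restrict_regularE p i x : K i x ->
  (polyfun p \_ (Omega z A `\` skeleton z A)) x = polyfun p x.
Proof. by move=> /Ktri_sub_regular reg; rewrite patchT ?inE. Qed.

Lemma restrict_polyfun0 : polyfun (0 : mpoly 2 R) \_ (Omega z A) = 0.
Proof. by apply/funext => x; rewrite /patch polyfun0; case: ifP. Qed.

Lemma regular_orthogonal_eq0 n u : (0 < n)%N -> Pspace n (Omega z A) u ->
    (forall w, PspaceT n.-1 z A w ->
       ip_patch z A (u \_ (Omega z A `\` skeleton z A)) w = 0) ->
  u = 0.
Proof.
move=> n0 [p pn <-]; rewrite restrict_regular => u0.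
rewrite (patch_orthogonal_eq0 n0 pn (@restrict_regularE p) u0).
exact: restrict_polyfun0.
Qed.

Lemma bigcap_Porth_poly n : (0 < n)%N ->
  \bigcap_(i in [set: 'I_q]) Porth_poly n z (A (ord_pred i)) (A i) = [set 0].
Proof.
move=> n0; apply/seteqP; split=> [p pP|_ -> i _] /=.
  have i0 : 'I_q by exact: Ordinal (ltnW (ltnW (patch_ge3 hT))).
  have pn : degree_le n p by have [] := pP i0 I.
  apply: (orthogonal_on_patch_eq0 hT n0 pn) => i w wn.
  have [_ [_ /(_ (polyfun w \_ (K i)))]] := pP i I.
  rewrite (@ip_triangleE _ _ _ _ _ _ p w) => [|x Kx|x Kx].
  - by apply; exists w => //; rewrite /degree_le prednK.
  - by rewrite patchT// inE.
  - by rewrite patchT// inE.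
split; first by rewrite /degree_le msize0.
split; first by exists 0 => //; rewrite /degree_le msize0.
move=> _ [w _ <-]; rewrite (@ip_triangleE _ _ _ _ _ _ 0 w) => [|x Kx|x Kx].
- by rewrite !mul0r -(scale0r (1 : mpoly 2 R)) (tri_intZ (nd i)) mul0r.
- by rewrite patchT// inE.
- by rewrite patchT// inE.
Qed.

(** If [p1] and [p2] have the same projection, with pieces [v i], then [p1 - v i] and [p2 - v i] are
    both orthogonal to lower degree on each triangle. Hence so is [p1 - p2], which no longer depends
    on [i]. *)
Lemma PiT_injective n : (0 < n)%N ->
  {in Pspace n (Omega z A) &, injective (PiT n z A)}.
Proof.
move=> n0 _ _ /set_mem[p1 p1n <-] /set_mem[p2 p2n <-].
rewrite /PiT !restrict_regular => e; congr (_ \_ _); congr polyfun.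
have [vP v1] := orth_proj_spec n.-1 p1; have [_ v2] := orth_proj_spec n.-1 p2.
rewrite -e in v2; have [v vn vE] := PspaceT_piecewise vP.
have loc p : (forall w, PspaceT n.-1 z A w -> ip_patch z A
    (polyfun p \_ (Omega z A `\` skeleton z A) - orth_proj n.-1 z A
      (polyfun p1 \_ (Omega z A `\` skeleton z A))) w = 0) ->
    forall i w, (msize w <= n)%N -> J i ((p - v i) * w * om i) = 0.
  move=> h i w wn; apply: (ip_patch_local (v := fun i => p - v i) n0 _ h i wn).
  by move=> j x Kx; rewrite polyfunB -(vE _ _ Kx) -(restrict_regularE p Kx).
apply/eqP; rewrite -subr_eq0; apply/eqP.
apply: (orthogonal_on_patch_eq0 hT n0) => [|i w wn]; first exact: msize_sub.
rewrite (_ : p1 - p2 = p1 - v i - (p2 - v i)); last by ring.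
have := loc _ v1 i w wn; have := loc _ v2 i w wn; rewrite /J => e2 e1.
by rewrite mulrBl mulrBl tri_intB// e1 e2 subrr.
Qed.

End PiecewisePolynomials.

Theorem theorem1p1 (R : realType) (z : R * R) (q : nat) (A : 'I_q -> R * R)
    (n : nat) (hT : triangle_patch z A) (hn : (1 <= n)%N) :
  let a := forall u, Pspace n (Omega z A) u ->
    (forall w, PspaceT n.-1 z A w ->
       ip_patch z A (u \_ (Omega z A `\` skeleton z A)) w = 0) ->
    u = 0 in
  let b := \bigcap_(i in [set: 'I_q]) Porth_poly n z (A (ord_pred i)) (A i) =
    [set 0] in
  let c := {in Pspace n (Omega z A) &, injective (PiT n z A)} in
  [/\ a <-> b, b <-> c & a <-> c] /\ [/\ a, b & c].
Proof.
have ha := fun u => @regular_orthogonal_eq0 R z q A hT n u hn.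
have hb := bigcap_Porth_poly hT hn; have hc := PiT_injective hT hn.
by move=> a b c; split; split.
Qed.
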